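(* Let $K$ be a field, $\lambda\in K$, $X$ a well-ordered set, and $\Omega=\{P\}$ with $P$ a unary operator symbol. Let $D\langle X;\Omega\rangle$ be the free $\lambda$-differential associative algebra on $X$ with operator $\Omega=\{P\}$, with $K$-basis $\mathfrak{L}(X)$ and with the order $>$ on $\mathfrak{L}(X)$ described in the context. Let $S$ be the subset of $D\langle X;\Omega\rangle$ consisting of the polynomials 1. $P(u)P(v)-P(uP(v))-P(P(u)v)-\lambda P(uv)$, for $u,v\in\mathfrak{L}(X)$, 2. $D(P(u))-u$, for $u\in\mathfrak{L}(X)$. Then, with respect to the order $>$, $S$ is a Gröbner-Shirshov basis in $D\langle X;\Omega\rangle$.
   Context: **The free algebra.** A $\lambda$-differential algebra is an associative $K$-algebra $R$ (not necessarily unital) with a $K$-linear map $D:R\to R$ satisfying $D(xy)=D(x)y+xD(y)+\lambda D(x)D(y)$. Here it is additionally equipped with a linear operator $P$. For a set $Y$ let $D^{\omega}(Y)=\{D^i(y)\mid i\ge 0,\ y\in Y\}$ be a set of formal symbols, with $D^0(y)=y$, and let $S(Y)$ denote the free semigroup (nonempty words) on $Y$. Put $X_0=X$, $\mathfrak{L}_0=S(D^{\omega}(X_0))$ and, for $n\ge1$, $X_n=X\cup\Omega(\mathfrak{L}_{n-1})$, $\mathfrak{L}_n=S(D^{\omega}(X_n))$, where $\Omega(\mathfrak{L})=\{P(y)\mid y\in\mathfrak{L}\}$ (formal expressions). Then $\mathfrak{L}_0\subset\mathfrak{L}_1\subset\cdots$; put $\mathfrak{L}(X)=\bigcup_n\mathfrak{L}_n$.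 Each $v\in\mathfrak{L}(X)$ is uniquely $v=v_1\cdots v_n$ with $v_i\in D^{\omega}(X\cup\Omega(\mathfrak{L}(X)))$; put $bre(v)=n$. Let $D\langle X;\Omega\rangle=K\mathfrak{L}(X)$ be the semigroup algebra. The linear map $D$ on it is defined on words by induction on breadth: $D(D^i(y))=D^{i+1}(y)$ for $y\in X\cup\Omega(\mathfrak{L}(X))$, and $D(u_1u_2\cdots u_t)=\lambda D(u_1)D(u_2\cdots u_t)+D(u_1)u_2\cdots u_t+u_1D(u_2\cdots u_t)$ for $t>1$. The operator $P$ acts by $v\mapsto P(v)$ on words, extended linearly. **The order.** Let $deg_\Omega(u)$ be the number of occurrences of $P$ in $u$. All tuples are compared lexicographically. On $\mathfrak{L}_0$: $D^i(x)>D^j(y)$ ($x,y\in X$) if $(i,x)>(j,y)$; and $u_1\cdots u_t>v_1\cdots v_s$ ($u_i,v_j\in D^\omega(X)$) if $(t,u_1,\dots,u_t)>(s,v_1,\dots,v_s)$. For $n>0$, by induction: on $X_n$, every $x\in X$ is smaller than every element of $\Omega(\mathfrak{L}_{n-1})$, and $P(u_1)>P(v_1)$ if $(deg_\Omega(P(u_1)),u_1)>(deg_\Omega(P(v_1)),v_1)$; on $D^\omega(X_n)$, $D^i(u)>D^j(v)$ ($u,v\in X_n$) if $(deg_\Omega(u),i,u)>(deg_\Omega(v),j,v)$; on $\mathfrak{L}_n$, $u=u_1\cdots u_t>v=v_1\cdots v_s$ if $(deg_\Omega(u),bre(u),u_1,\dots,u_t)>(deg_\Omega(v),bre(v),v_1,\dots,v_s)$.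 This gives a well ordering on $\mathfrak{L}(X)$. For $0\ne f\in D\langle X;\Omega\rangle$, $\bar f$ is the largest word occurring in $f$ with nonzero coefficient, $lc(f)$ is its coefficient, and $f$ is monic if $lc(f)=1$. A subset is monic if all its elements are. **$\star$-words.** For $\star\notin X$, $\mathfrak{L}^\star(X)$ is the set of elements of $\mathfrak{L}(X\cup\{\star\})$ with exactly one occurrence of $\star$. For $u\in\mathfrak{L}^\star(X)$ and $s\in D\langle X;\Omega\rangle$, $u|_s\in D\langle X;\Omega\rangle$ is obtained by replacing $\star$ by $s$ and evaluating in $D\langle X;\Omega\rangle$; it is called an $s$-word. It is a normal $s$-word if $\overline{u|_s}=u|_{\bar s}$. **Compositions.** Let $f,g\in D\langle X;\Omega\rangle$ be monic and $i,j\ge0$. (i) If $w=\overline{D^i(f)}\,a=b\,\overline{D^j(g)}$ for some $a,b\in\mathfrak{L}(X)$ with $bre(w)<bre(\bar f)+bre(\bar g)$, then $(f,g)_w=lc(D^i(f))^{-1}D^i(f)a-lc(D^j(g))^{-1}bD^j(g)$ is an intersection composition. (ii) If $w=\overline{D^i(f)}=u|_{\overline{D^j(g)}}$ for some $u\in\mathfrak{L}^\star(X)$, then $(f,g)_w=lc(D^i(f))^{-1}D^i(f)-lc(D^j(g))^{-1}u|_{D^j(g)}$ is an including composition. **Gröbner-Shirshov basis.** For a monic set $S$, $w\in\mathfrak{L}(X)$ and $p,q\in D\langle X;\Omega\rangle$, write $p\equiv q\ mod(S,w)$ if $p-q=\sum\alpha_iu_i|_{D^{l_i}(s_i)}$ (finite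 sum) with $\alpha_i\in K$, $u_i\in\mathfrak{L}^\star(X)$, $s_i\in S$, $l_i\ge0$, each $u_i|_{D^{l_i}(s_i)}$ a normal $D^{l_i}(s_i)$-word and $u_i|_{\overline{D^{l_i}(s_i)}}<w$. $S$ is a Gröbner-Shirshov basis if every composition $(f,g)_w$ with $f,g\in S$ satisfies $(f,g)_w\equiv0\ mod(S,w)$. *)

(* Defs.v *)
From HB Require Import structures.
From mathcomp Require Import all_boot all_order all_algebra.
From mathcomp Require Import finmap.
From mathcomp.multinomials Require Import monalg.

Set Implicit Arguments.
Unset Strict Implicit.
Unset Printing Implicit Defensive.

Import Order.TTheory GRing.Theory.

Local Open Scope ring_scope.

(* [gen X], [letter X] and [word X] stand for X \cup \Omega(L(X)),            *)
(* D^\omega(X \cup \Omega(L(X))) and L(X): as least fixed points they are the *)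
(* unions of the chains X_n, D^\omega(X_n) and L_n.  Words are nonempty, and  *)
(* [Der 0 y] is y itself.                                                     *)
Inductive gen (X : Type) : Type :=
  | Var of X
  | Op of word X
with letter (X : Type) : Type :=
  | Der of nat & gen X
with word (X : Type) : Type :=
  | Single of letter X
  | Cons of letter X & word X.

Arguments Var {X}.
Arguments Op {X}.
Arguments Der {X}.
Arguments Single {X}.
Arguments Cons {X}.

Scheme gen_mut := Induction for gen Sort Prop
  with letter_mut := Induction for letter Sort Prop
  with word_mut := Induction for word Sort Prop.
Combined Scheme words_ind from gen_mut, letter_mut, word_mut.

Section Encoding.
Variable X : Type.

Fixpoint enc_gen (g : gen X) : GenTree.tree X :=
  match g with
  | Var x => GenTree.Leaf x
  | Op w => GenTree.Node 0 [:: enc_word w]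
  end
with enc_letter (l : letter X) : GenTree.tree X :=
  let: Der i g := l in GenTree.Node i [:: enc_gen g]
with enc_word (w : word X) : GenTree.tree X :=
  match w with
  | Single l => GenTree.Node 0 [:: enc_letter l]
  | Cons l w' => GenTree.Node 1 [:: enc_letter l; enc_word w']
  end.

Fixpoint dec_gen (t : GenTree.tree X) : option (gen X) :=
  match t with
  | GenTree.Leaf x => Some (Var x)
  | GenTree.Node _ [:: t'] => omap Op (dec_word t')
  | _ => None
  end
with dec_letter (t : GenTree.tree X) : option (letter X) :=
  match t with
  | GenTree.Node i [:: t'] => omap (Der i) (dec_gen t')
  | _ => None
  end
with dec_word (t : GenTree.tree X) : option (word X) :=
  match t with
  | GenTree.Node 0 [:: t'] => omap Single (dec_letter t')
  | GenTree.Node 1 [:: t1; t2] =>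
      obind (fun l => omap (Cons l) (dec_word t2)) (dec_letter t1)
  | _ => None
  end.

Lemma enc_dec : pcancel enc_gen dec_gen /\
  (pcancel enc_letter dec_letter /\ pcancel enc_word dec_word).
Proof.
apply: words_ind => //= [w ->|i g ->|l ->|l -> w ->] //.
Qed.

Lemma enc_genK : pcancel enc_gen dec_gen.
Proof. by case: enc_dec. Qed.

Lemma enc_letterK : pcancel enc_letter dec_letter.
Proof. by case: enc_dec => _ []. Qed.

Lemma enc_wordK : pcancel enc_word dec_word.
Proof. by case: enc_dec => _ []. Qed.

End Encoding.

#[hnf] HB.instance Definition _ (X : choiceType) :=
  Choice.copy (gen X) (pcan_type (@enc_genK X)).
#[hnf] HB.instance Definition _ (X : choiceType) :=
  Choice.copy (letter X) (pcan_type (@enc_letterK X)).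
#[hnf] HB.instance Definition _ (X : choiceType) :=
  Choice.copy (word X) (pcan_type (@enc_wordK X)).

Section Words.
Variable X : Type.

Fixpoint bre (w : word X) : nat :=
  if w is Cons _ w' then (bre w').+1 else 1.

Fixpoint wcat (u v : word X) : word X :=
  match u with
  | Single l => Cons l v
  | Cons l u' => Cons l (wcat u' v)
  end.

(* deg_\Omega *)
Fixpoint deg_gen (g : gen X) : nat :=
  match g with
  | Var _ => 0
  | Op w => (deg w).+1
  end
with deg_letter (l : letter X) : nat := let: Der _ g := l in deg_gen g
with deg (w : word X) : nat :=
  match w with
  | Single l => deg_letter l
  | Cons l w' => deg_letter l + deg w'
  end.

Definition pword (w : word X) : word X := Single (Der 0 (Op w)).

End Words.

Definition lexn (m n : nat) (b : bool) : bool := (m < n)%N || (m == n) && b.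

Definition deg_bre_lex (X : Type) (u v : word X) (b : bool) : bool :=
  lexn (deg u) (deg v) (lexn (bre u) (bre v) b).

Section Order.
Variables (d : Order.disp_t) (X : orderType d).

(* [letters_lt] compares the letters of two words of equal breadth           *)
(* lexicographically; its value on words of different breadth is irrelevant.  *)
Fixpoint gen_lt (g h : gen X) : bool :=
  match g, h with
  | Var x, Var y => (x < y)%O
  | Var _, Op _ => true
  | Op _, Var _ => false
  | Op u, Op v =>
      lexn (deg_gen g) (deg_gen h) (deg_bre_lex u v (letters_lt u v))
  end
with letter_lt (l m : letter X) : bool :=
  let: Der i g := l in let: Der j h := m in
  lexn (deg_gen g) (deg_gen h) (lexn i j (gen_lt g h))
with letters_lt (u v : word X) : bool :=
  match u, v with
  | Single l, Single m => letter_lt l m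
  | Cons l u', Cons m v' => letter_lt l m || (l == m) && letters_lt u' v'
  | _, _ => false
  end.

Definition word_lt (u v : word X) : bool := deg_bre_lex u v (letters_lt u v).

Lemma lexn_trans m n p (a b c : bool) :
  (a -> b -> c) -> lexn m n a -> lexn n p b -> lexn m p c.
Proof.
rewrite /lexn => abc; case: ltngtP => //= [mn _|-> ha].
  by case: ltngtP => //= [np _|<- _]; rewrite ?mn ?(ltn_trans mn np).
by case: ltngtP => //= _ hb; apply: abc.
Qed.

Lemma lexn_total m n (a b : bool) : (m = n -> a || b) -> lexn m n a || lexn n m b.
Proof. by rewrite /lexn; case: ltngtP => //= -> ->. Qed.

Lemma lts_irr : (irreflexive gen_lt) /\
  (irreflexive letter_lt /\ irreflexive letters_lt).
Proof.
apply: words_ind => /= [x|w ih|i g ih|l ih|l ih w ihw] /=;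
  rewrite ?ltxx // /deg_bre_lex /lexn ?ltnn ?eqxx /= ?ltnn ?ih //.
Qed.

Lemma lts_trans :
  (forall g h k, gen_lt g h -> gen_lt h k -> gen_lt g k) /\
  ((forall l m n, letter_lt l m -> letter_lt m n -> letter_lt l n) /\
   (forall u v w, letters_lt u v -> letters_lt v w -> letters_lt u w)).
Proof.
apply: words_ind => [x|w ih|i g ih|l ih|l ih w ihw].
- by case=> [y|u] [z|v] //=; apply: lt_trans.
- by case=> [y|u] [z|v] //=; do 3!apply: lexn_trans; apply: ih.
- by case=> j h [k g'] /=; do 2!apply: lexn_trans; apply: ih.
- by case=> [m|m v] [n|n w] //=; apply: ih.
- case=> [m|m v] [n|n w'] //= /orP[lm|/andP[/eqP-> uv]] /orP[mn|/andP[/eqP<- vw]].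
  + by rewrite (ih _ _ lm mn).
  + by rewrite lm.
  + by rewrite mn.
  + by rewrite eqxx (ihw _ _ uv vw) orbT.
Qed.

Lemma lts_total :
  (forall g h, g != h -> gen_lt g h || gen_lt h g) /\
  ((forall l m, l != m -> letter_lt l m || letter_lt m l) /\
   (forall u v, bre u = bre v -> u != v -> letters_lt u v || letters_lt v u)).
Proof.
apply: words_ind => [x|w ih|i g ih|l ih|l ih w ihw].
- case=> [y|u] //= ne; apply: lt_total.
  by apply: contraNneq ne => ->.
- case=> [y|u] //= ne; apply: lexn_total => _.
  rewrite /deg_bre_lex; apply: lexn_total => _; apply: lexn_total => e.
  by apply: ih => //; apply: contraNneq ne => ->.
- case=> j h /= ne; apply: lexn_total => _; apply: lexn_total => e.
  by apply: ih; apply: contraNneq ne => ->; rewrite e.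
- case=> [m|m v] //= e ne; last by case: v e ne.
  by apply: ih; apply: contraNneq ne => ->.
- case=> [m|m v] /= e ne; first by case: w e {ihw ne}.
  have [elm|] := eqVneq l m; last first.
    by move=> nlm; case/orP: (ih _ nlm) => ->; rewrite ?orbT.
  have/orP[->|->] : letters_lt w v || letters_lt v w; rewrite ?orbT //.
  apply: ihw; first by case: e.
  by apply: contraNneq ne => ->; rewrite elm.
Qed.

Lemma word_lt_irr : irreflexive word_lt.
Proof.
by move=> w; rewrite /word_lt /deg_bre_lex /lexn !ltnn !eqxx /= lts_irr.2.2.
Qed.

Lemma word_lt_trans : transitive word_lt.
Proof.
by move=> v u w; do 2!apply: lexn_trans; apply: lts_trans.2.2.
Qed.

Lemma word_lt_total u v : u != v -> word_lt u v || word_lt v u.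
Proof.
move=> ne; apply: lexn_total => _; apply: lexn_total => e.
exact: lts_total.2.2.
Qed.

End Order.

Fact word_display : Order.disp_t. Proof. exact: Order.Disp tt tt. Qed.

HB.instance Definition _ (d : Order.disp_t) (X : orderType d) :=
  Order.LtOrder.Build word_display (word X)
    (fun _ _ => erefl) (fun _ _ => erefl) (fun _ _ => erefl)
    (@word_lt_irr d X) (@word_lt_trans d X) (@word_lt_total d X).

Section FreeAlgebra.
Variables (K : fieldType) (X : choiceType) (lambda : K).

(* D<X; \Omega> *)
Notation A := {malg K[word X]}.

Definition linext (F : word X -> A) (f : A) : A :=
  \sum_(w <- msupp f) f@_w *: F w.

Definition amul (f g : A) : A :=
  linext (fun u => linext (fun v => << wcat u v >>) g) f.

Definition Dletter (l : letter X) : A :=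
  let: Der i y := l in << Single (Der i.+1 y) >>.

Fixpoint Dword (w : word X) : A :=
  match w with
  | Single l => Dletter l
  | Cons l w' =>
      lambda *: amul (Dletter l) (Dword w') + amul (Dletter l) << w' >>
        + amul << Single l >> (Dword w')
  end.

Definition Dop (f : A) : A := linext Dword f.

Definition Pop (f : A) : A := linext (fun w => << pword w >>) f.

Definition Diter (i : nat) (f : A) : A := iter i Dop f.

(* The star is [None] in [option X]; [stars] counts its occurrences. *)
Fixpoint stars_gen (g : gen (option X)) : nat :=
  match g with
  | Var x => ~~ isSome x
  | Op w => stars w
  end
with stars_letter (l : letter (option X)) : nat :=
  let: Der _ g := l in stars_gen g
with stars (w : word (option X)) : nat :=
  match w with
  | Single l => stars_letter l
  | Cons l w' => stars_letter l + stars w'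
  end.

Definition star_word (u : word (option X)) : bool := stars u == 1.

Fixpoint subst_gen (s : A) (g : gen (option X)) : A :=
  match g with
  | Var (Some x) => << Single (Der 0 (Var x)) >>
  | Var None => s
  | Op w => Pop (subst s w)
  end
with subst_letter (s : A) (l : letter (option X)) : A :=
  let: Der i g := l in Diter i (subst_gen s g)
with subst (s : A) (u : word (option X)) : A :=
  match u with
  | Single l => subst_letter s l
  | Cons l u' => amul (subst_letter s l) (subst s u')
  end.

End FreeAlgebra.

Section GroebnerShirshov.
Variables (K : fieldType) (d : Order.disp_t) (X : orderType d) (lambda : K).

Notation A := {malg K[word X]}.

(* w is the leading word of f; no w satisfies this when f = 0, and the        *)
(* leading coefficient is then f@_w.                                          *)
Definition lead (f : A) (w : word X) : Prop :=
  w \in msupp f /\ forall v, v \in msupp f -> (v <= w)%O.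

Definition monic (f : A) : Prop := exists2 w, lead f w & f@_w = 1.

(* u|_s is a normal s-word with leading word v. *)
Definition normal_lead (u : word (option X)) (s : A) (v : word X) : Prop :=
  lead (subst lambda s u) v /\
  exists2 m, lead s m & subst lambda << m >> u = << v >>.

(* [composition f g w h] : h is a composition (f, g)_w. *)
Inductive composition (f g : A) (w : word X) : A -> Prop :=
  | Intersection (i j : nat) (a b mf mg mi mj : word X) of
      lead f mf & lead g mg &
      lead (Diter lambda i f) mi & lead (Diter lambda j g) mj &
      w = wcat mi a & w = wcat b mj & (bre w < bre mf + bre mg)%N :
      composition f g w
        (((Diter lambda i f)@_mi)^-1 *: amul (Diter lambda i f) << a >>
         - ((Diter lambda j g)@_mj)^-1 *: amul << b >> (Diter lambda j g))
  | Including (i j : nat) (u : word (option X)) (mj : word X) of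
      star_word u &
      lead (Diter lambda i f) w & lead (Diter lambda j g) mj &
      subst lambda << mj >> u = << w >> :
      composition f g w
        (((Diter lambda i f)@_w)^-1 *: Diter lambda i f
         - ((Diter lambda j g)@_mj)^-1 *: subst lambda (Diter lambda j g) u).

Definition congr_mod (S : A -> Prop) (w : word X) (p q : A) : Prop :=
  exists (n : nat) (alpha : 'I_n -> K) (u : 'I_n -> word (option X))
         (s : 'I_n -> A) (l : 'I_n -> nat),
    (forall i, [/\ star_word (u i), S (s i) &
       exists2 v, normal_lead (u i) (Diter lambda (l i) (s i)) v & (v < w)%O])
    /\ p - q = \sum_(i < n) alpha i *: subst lambda (Diter lambda (l i) (s i)) (u i).

Definition groebner_shirshov (S : A -> Prop) : Prop :=
  (forall f, S f -> monic f) /\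
  (forall f g w h, S f -> S g -> composition f g w h -> congr_mod S w h 0).

Inductive diff_rota_baxter : A -> Prop :=
  | RBrel (u v : word X) :
      diff_rota_baxter
        (amul (Pop << u >>) (Pop << v >>) - Pop (amul << u >> (Pop << v >>))
         - Pop (amul (Pop << u >>) << v >>) - lambda *: Pop (amul << u >> << v >>))
  | DPrel (u : word X) :
      diff_rota_baxter (Dop lambda (Pop << u >>) - << u >>).

End GroebnerShirshov.

(* Main.v *)
Require Import Defs.
From mathcomp Require Import all_boot all_order all_algebra.
From mathcomp Require Import finmap ring zify.
From mathcomp.multinomials Require Import monalg.
Import Defs.

Set Implicit Arguments.
Unset Strict Implicit.
Unset Printing Implicit Defensive.

Import Order.TTheory GRing.Theory.

Local Open Scope ring_scope.

(** The relations say that [P] is a Rota-Baxter operator and a section of [D].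
    Both can be read as rewriting rules, and the theorem says that the critical
    pairs of the two rules, closed under derivation, resolve.

    Write [F(u,v) = P(u)P(v) - P(uP(v)) - P(P(u)v) - lambda P(uv)] and
    [G(u) = D(P(u)) - u].  The map [D] is strictly increasing on leading words
    and multiplies leading coefficients by nonzero scalars ([top_der]): the
    leading word of [D(w)] differentiates every letter of [w] if
    [lambda != 0], and only the first letter if [lambda = 0].  Hence [D^i(G(u))]
    has leading word [D^(i+1)(P(u))], and [D^i(F(u,v))] has leading word
    [D^i(P(u)) D^i(P(v))], or [D^i(P(u)) P(v)] if [lambda = 0].

    Three observations reduce all compositions to a few computations.
    - [D] preserves the degree in [P], and the span of the normal words is stable
      under [D] with the expected bound on leading words ([red_der_normal]).  So
      whatever lies in the ideal and has lost a [P] may be differentiated freely.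
    - [D(F(u,v))] is a combination of the [G] ([der_rb_defect]).  Up to smaller
      normal words and a scalar, [D^(i+1)(F(u,v))] is therefore
      [D^i(G(u))] times the second letter of its leading word
      ([dern_rb_defect]), so a derived [F] composes as a [G] does.
    - For [A = D^(i+1)(P(u))], [a = D^i(u)], [g = A - a = D^i(G(u))], and any
      monic normal word [q] with leading word [z], the identity
      [g z - A q = g (z - q) - a q] shows that [g] and [q] placed side by side
      always resolve ([dp_mul_composition]): [z - q] is below [z], and [a] has
      lost a [P].

    What remains are the compositions inside the argument of [P]
    ([dp_composition], [rb_composition_l], [rb_composition_r]), where the outer
    relation is applied to the smaller words of the inner one, and the overlap
    [P(u)P(v)P(w)] ([rb_intersection]), which is the associativity of the
    Rota-Baxter product ([rb_assoc]). *)

(** * Words and their order *)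

Section WordMonoid.
Variable X : Type.
Implicit Types u v w : word X.

Lemma wcatA u v w : wcat u (wcat v w) = wcat (wcat u v) w.
Proof. by elim: u => //= l u ->. Qed.

Lemma bre_cat u v : bre (wcat u v) = (bre u + bre v)%N.
Proof. by elim: u => //= l u ->. Qed.

Lemma bre_gt0 u : (0 < bre u)%N.
Proof. by case: u. Qed.

Lemma bre1 u : bre u = 1 -> exists l, u = Single l.
Proof. by case: u => [l _|l [?|? ?] //]; exists l. Qed.

Lemma deg_cat u v : deg (wcat u v) = (deg u + deg v)%N.
Proof. by elim: u => //= l u ->; rewrite addnA. Qed.

End WordMonoid.

Lemma lexn_idem m n b : lexn m n (lexn m n b) = lexn m n b.
Proof. by rewrite /lexn; case: ltngtP => //= _; rewrite orbF. Qed.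

Lemma lexn_diag n b : lexn n n b = b.
Proof. by rewrite /lexn ltnn eqxx. Qed.

Section OrderTheory.
Variables (d : Order.disp_t) (X : orderType d).
Implicit Types (u v w : word X) (l m : letter X).

Lemma wltE u v : (u < v)%O = word_lt u v.
Proof. by []. Qed.

Lemma wlt_deg u v : (deg u < deg v)%N -> (u < v)%O.
Proof. by rewrite wltE /word_lt /deg_bre_lex /lexn => ->. Qed.

Lemma wlt_bre u v : deg u = deg v -> (bre u < bre v)%N -> (u < v)%O.
Proof.
by rewrite wltE /word_lt /deg_bre_lex => ->; rewrite lexn_diag /lexn => ->.
Qed.

Lemma letter_lt_irr l : letter_lt l l = false.
Proof. exact: (lts_irr X).2.1. Qed.

Lemma letters_lt_irr u : letters_lt u u = false.
Proof. exact: (lts_irr X).2.2. Qed.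

Lemma letters_lt_cat2l w u v :
  letters_lt (wcat w u) (wcat w v) = letters_lt u v.
Proof.
by elim: w => [l|l w ih] /=; rewrite letter_lt_irr eqxx //= ih.
Qed.

Lemma letters_lt_cat2r w u v : bre u = bre v ->
  letters_lt (wcat u w) (wcat v w) = letters_lt u v.
Proof.
elim: u v => [l|l u ih] [m|m v] //=; try by [case: v|case: u {ih}].
  by rewrite letters_lt_irr andbF orbF.
by case=> /ih ->.
Qed.

Lemma ltw_cat2l w u v : (wcat w u < wcat w v)%O = (u < v)%O.
Proof.
rewrite !wltE /word_lt /deg_bre_lex !deg_cat !bre_cat letters_lt_cat2l.
by rewrite /lexn !ltn_add2l !eqn_add2l.
Qed.

Lemma ltw_cat2r w u v : (wcat u w < wcat v w)%O = (u < v)%O.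
Proof.
rewrite !wltE /word_lt /deg_bre_lex !deg_cat !bre_cat.
rewrite /lexn !ltn_add2r !eqn_add2r; congr (_ || (_ && (_ || _))).
by case: eqVneq => //= e; rewrite letters_lt_cat2r.
Qed.

Definition opw i w : word X := Single (Der i (Op w)).

Lemma ltw_opw i u v : (opw i u < opw i v)%O = (u < v)%O.
Proof.
rewrite !wltE /word_lt /deg_bre_lex /= !lexn_diag.
by rewrite /deg_bre_lex !lexn_idem.
Qed.

Lemma lew_cat2l w u v : (wcat w u <= wcat w v)%O = (u <= v)%O.
Proof. by rewrite !leNgt ltw_cat2l. Qed.

Lemma lew_cat2r w u v : (wcat u w <= wcat v w)%O = (u <= v)%O.
Proof. by rewrite !leNgt ltw_cat2r. Qed.

Lemma lew_opw i u v : (opw i u <= opw i v)%O = (u <= v)%O.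
Proof. by rewrite !leNgt ltw_opw. Qed.

Lemma wcat_ltle u v u' v' :
  (u < u')%O -> (v <= v')%O -> (wcat u v < wcat u' v')%O.
Proof.
move=> hu hv; apply: (@le_lt_trans _ _ (wcat u v')); first by rewrite lew_cat2l.
by rewrite ltw_cat2r.
Qed.

Lemma wcat_le u v u' v' :
  (u <= u')%O -> (v <= v')%O -> (wcat u v <= wcat u' v')%O.
Proof.
move=> hu hv; apply: (@le_trans _ _ (wcat u v')); first by rewrite lew_cat2l.
by rewrite lew_cat2r.
Qed.

Lemma lew_deg u v : (u <= v)%O -> (deg u <= deg v)%N.
Proof. by rewrite leNgt; apply: contraNleq => /wlt_deg. Qed.

End OrderTheory.

(** * The free algebra presented by its basis *)

Section Linearity.
Variables (K : fieldType) (U V : lmodType K) (f : U -> V).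
Hypothesis lf : linear f.
Implicit Types (p q : U) (c : K).

Lemma lin_scalable c p : f (c *: p) = c *: f p.
Proof. exact: (GRing.scalable_linear lf). Qed.

Lemma lin_add p q : f (p + q) = f p + f q.
Proof. by have := lf 1 p q; rewrite !scale1r. Qed.

Lemma lin_sub p q : f (p - q) = f p - f q.
Proof. by rewrite lin_add -scaleN1r lin_scalable scaleN1r. Qed.

Lemma lin_0 : f 0 = 0.
Proof. by rewrite -(scale0r 0) lin_scalable scale0r. Qed.

Lemma lin_opp p : f (- p) = - f p.
Proof. by rewrite -scaleN1r lin_scalable scaleN1r. Qed.

End Linearity.

(** The free algebra is determined by its basis of words and by the values of
    its operations there.  The argument is carried out in an abstract algebra
    with such a basis, so that it computes with words only and never with the
    representation of polynomials as finitely supported functions. *)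
Record free_algebra (K : fieldType) (X : choiceType) (lambda : K) :=
  FreeAlgebra {
    carrier :> lmodType K;
    coef : word X -> carrier -> K;
    mono : word X -> carrier;
    mul : carrier -> carrier -> carrier;
    der : carrier -> carrier;
    op : carrier -> carrier;
    coef_linear : forall w, scalar (coef w);
    coef_mono : forall v w, coef w (mono v) = (v == w)%:R;
    mono_span : forall p, exists2 s : seq (word X),
      forall w, w \in s -> coef w p != 0
      & p = \sum_(w <- s) coef w p *: mono w;
    mull_linear : forall q, linear (mul^~ q);
    mulr_linear : forall p, linear (mul p);
    mul_mono : forall u v, mul (mono u) (mono v) = mono (wcat u v);
    der_linear : linear der;
    der_letter : forall i g,
      der (mono (Single (Der i g))) = mono (Single (Der i.+1 g));
    der_word : forall l w, der (mono (Cons l w)) =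
      lambda *: mul (der (mono (Single l))) (der (mono w))
      + mul (der (mono (Single l))) (mono w)
      + mul (mono (Single l)) (der (mono w));
    op_linear : linear op;
    op_mono : forall w, op (mono w) = mono (pword w) }.

Arguments mono {K X lambda F} w : rename.
Arguments coef {K X lambda F} w p : rename.
Arguments mul {K X lambda F} p q : rename.
Arguments der {K X lambda F} p : rename.
Arguments op {K X lambda F} p : rename.

Notation "p ** q" := (mul p q) (at level 40, left associativity).

Section FreeAlgebraTheory.
Variables (K : fieldType) (X : choiceType) (lambda : K).
Variable A : free_algebra X lambda.
Implicit Types (p q r : A) (u v w : word X) (a b c : K).

Lemma mulDl p q r : (p + q) ** r = p ** r + q ** r.
Proof. exact: (lin_add (@mull_linear _ _ _ A r)). Qed.
Lemma mulBl p q r : (p - q) ** r = p ** r - q ** r.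
Proof. exact: (lin_sub (@mull_linear _ _ _ A r)). Qed.
Lemma mulOppl p r : (- p) ** r = - (p ** r).
Proof. exact: (lin_opp (@mull_linear _ _ _ A r)). Qed.
Lemma mulZl c p r : (c *: p) ** r = c *: (p ** r).
Proof. exact: (lin_scalable (@mull_linear _ _ _ A r)). Qed.
Lemma mul0l r : 0 ** r = 0 :> A.
Proof. exact: (lin_0 (@mull_linear _ _ _ A r)). Qed.
Lemma mulDr p q r : r ** (p + q) = r ** p + r ** q.
Proof. exact: (lin_add (@mulr_linear _ _ _ A r)). Qed.
Lemma mulBr p q r : r ** (p - q) = r ** p - r ** q.
Proof. exact: (lin_sub (@mulr_linear _ _ _ A r)). Qed.
Lemma mulOppr p r : r ** (- p) = - (r ** p).
Proof. exact: (lin_opp (@mulr_linear _ _ _ A r)). Qed.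
Lemma mulZr c p r : r ** (c *: p) = c *: (r ** p).
Proof. exact: (lin_scalable (@mulr_linear _ _ _ A r)). Qed.
Lemma mul0r r : r ** 0 = 0 :> A.
Proof. exact: (lin_0 (@mulr_linear _ _ _ A r)). Qed.
Lemma derD p q : der (p + q) = der p + der q.
Proof. exact: (lin_add (@der_linear _ _ _ A)). Qed.
Lemma derB p q : der (p - q) = der p - der q.
Proof. exact: (lin_sub (@der_linear _ _ _ A)). Qed.
Lemma derZ c p : der (c *: p) = c *: der p.
Proof. exact: (lin_scalable (@der_linear _ _ _ A)). Qed.
Lemma der0 : der 0 = 0 :> A.
Proof. exact: (lin_0 (@der_linear _ _ _ A)). Qed.
Lemma opD p q : op (p + q) = op p + op q.
Proof. exact: (lin_add (@op_linear _ _ _ A)). Qed.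
Lemma opB p q : op (p - q) = op p - op q.
Proof. exact: (lin_sub (@op_linear _ _ _ A)). Qed.
Lemma opN p : op (- p) = - op p.
Proof. exact: (lin_opp (@op_linear _ _ _ A)). Qed.
Lemma opZ c p : op (c *: p) = c *: op p.
Proof. exact: (lin_scalable (@op_linear _ _ _ A)). Qed.
Lemma coefD w p q : coef w (p + q) = coef w p + coef w q.
Proof. exact: (@lin_add _ _ K^o _ (@coef_linear _ _ _ A w)). Qed.
Lemma coefN w p : coef w (- p) = - coef w p.
Proof. exact: (@lin_opp _ _ K^o _ (@coef_linear _ _ _ A w)). Qed.
Lemma coefB w p q : coef w (p - q) = coef w p - coef w q.
Proof. exact: (@lin_sub _ _ K^o _ (@coef_linear _ _ _ A w)). Qed.
Lemma coefZ w c p : coef w (c *: p) = c * coef w p.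
Proof. exact: (@lin_scalable _ _ K^o _ (@coef_linear _ _ _ A w)). Qed.
Lemma coef0 w : coef w (0 : A) = 0.
Proof. exact: (@lin_0 _ _ K^o _ (@coef_linear _ _ _ A w)). Qed.

Lemma coef_ext p q : (forall w, coef w p = coef w q) -> p = q.
Proof.
move=> pq; apply/eqP; rewrite -subr_eq0; apply/eqP.
have [s _ ->] := mono_span (p - q).
by rewrite big1 // => w _; rewrite coefB pq subrr scale0r.
Qed.

Definition coefE := (coefB, coefD, coefN, coefZ, coef0).

Definition supp (Q : word X -> Prop) p := forall w, coef w p != 0 -> Q w.

Lemma supp_ind Q (R : A -> Prop) p : supp Q p -> R 0 ->
  (forall c w q, Q w -> R q -> R (c *: mono w + q)) -> R p.
Proof.
move=> Qp R0 RD; have [s sp ->] := mono_span p; rewrite big_seq.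
by elim/big_rec: _ => // w q /sp /Qp; apply: RD.
Qed.

Lemma mono_ind (R : A -> Prop) : R 0 ->
  (forall c w q, R q -> R (c *: mono w + q)) -> forall p, R p.
Proof.
move=> R0 RD p; apply: (@supp_ind (fun=> True) R) => // c w q _; exact: RD.
Qed.

End FreeAlgebraTheory.

(* In an abstract module [ring] sees nothing; in the coefficients it decides. *)
Ltac linear_identity :=
  apply: coef_ext => ?; rewrite !coefE; ring.

Section DifferentialTheory.
Variables (K : fieldType) (X : choiceType) (lambda : K).
Variable A : free_algebra X lambda.
Implicit Types (p q r : A) (u v w : word X) (a b c : K).

Lemma mulA p q r : p ** (q ** r) = p ** q ** r.
Proof.
elim/mono_ind: p => [|a u p ih]; first by rewrite !mul0l.
rewrite !mulDl !mulZl ih; congr (_ *: _ + _) => {ih}.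
elim/mono_ind: q => [|b v q ih]; first by rewrite mul0l mul0r mul0l.
rewrite mulDl !mulDr mulDl !mulZr !mulZl ih mulZr; congr (_ *: _ + _) => {ih}.
elim/mono_ind: r => [|e w r ih]; first by rewrite !mul0r.
by rewrite !mulDr !mulZr ih !mul_mono wcatA.
Qed.

(** [der_word] only splits off the first letter; associativity propagates it to
    any factorization. *)
Lemma derM p q :
  der (p ** q) = lambda *: (der p ** der q) + der p ** q + p ** der q.
Proof.
elim/mono_ind: p => [|a u p ih].
  by rewrite mul0l der0 !mul0l scaler0 !addr0.
rewrite mulDl mulZl !derD !derZ ih !mulDl !mulZl.
suff ->: der (mono u ** q) =
    lambda *: (der (mono u) ** der q) + der (mono u) ** q + mono u ** der q.
  by linear_identity.
elim/mono_ind: q {ih} => [|b v q ih].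
  by rewrite der0 !mul0r der0 scaler0 !addr0.
rewrite mulDr mulZr !derD !derZ ih !mulDr !mulZr.
suff ->: der (mono u ** mono v) = lambda *: (der (mono u) ** der (mono v) : A)
    + der (mono u) ** mono v + mono u ** der (mono v).
  by linear_identity.
move=> {ih}; elim: u => [l|l u ih]; first by rewrite mul_mono der_word.
rewrite mul_mono /= !der_word -mul_mono ih.
rewrite -[mono (Cons l u)]/(mono (wcat (Single l) u)) -mul_mono.
rewrite !(mulDr, mulZr, mulDl, mulZl) !mulA.
by linear_identity.
Qed.

End DifferentialTheory.

(** * Leading words *)

Section Leading.
Variables (K : fieldType) (d : Order.disp_t) (X : orderType d) (lambda : K).
Variable A : free_algebra X lambda.
Implicit Types (p q r : A) (u v w m : word X) (a b c : K).
Implicit Types (Q : word X -> Prop).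

Lemma supp0 Q : supp Q (0 : A).
Proof. by move=> w; rewrite coef0 eqxx. Qed.

Lemma suppW Q Q' p : (forall w, Q w -> Q' w) -> supp Q p -> supp Q' p.
Proof. by move=> sub Qp w /Qp /sub. Qed.

Lemma suppD Q p q : supp Q p -> supp Q q -> supp Q (p + q).
Proof.
move=> Qp Qq w; rewrite coefD; have [p0|/Qp //] := eqVneq (coef w p) 0.
by rewrite p0 add0r => /Qq.
Qed.

Lemma suppZ Q c p : supp Q p -> supp Q (c *: p).
Proof. by move=> Qp w; rewrite coefZ mulf_eq0 => /norP[_ /Qp]. Qed.

Lemma suppN Q p : supp Q p -> supp Q (- p).
Proof. by move=> Qp w; rewrite coefN oppr_eq0 => /Qp. Qed.

Lemma supp_mono Q w : Q w -> supp Q (mono w : A).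
Proof.
by move=> Qw v; rewrite coef_mono; case: (w =P v) => [<- //|_]; rewrite eqxx.
Qed.

Lemma supp_linear Q Q' (f : A -> A) p : linear f -> supp Q p ->
  (forall w, Q w -> supp Q' (f (mono w))) -> supp Q' (f p).
Proof.
move=> lf Qp Qf.
apply: (supp_ind (R := fun p => supp Q' (f p)) Qp) => [|c w q Qw ih].
  by rewrite (lin_0 lf); apply: supp0.
by rewrite lf; apply: suppD ih; apply: suppZ; apply: Qf.
Qed.

Definition below w p := supp (fun v => (v < w)%O) p.

(** For [c != 0] this says that [m] is the leading word of [p] and [c] its
    leading coefficient; leaving [c] unconstrained makes it stable under
    scaling and linear maps. *)
Definition top p m c := below m (p - c *: mono m).

Lemma top_mono w : top (mono w) w 1.
Proof. by rewrite /top scale1r subrr; apply: supp0. Qed.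

Lemma top_supp p m c : top p m c -> supp (fun v => (v <= m)%O) p.
Proof.
move=> tp; rewrite -(subrK (c *: mono m) p); apply: suppD.
  by apply: suppW tp => v /ltW.
by apply: suppZ; apply: supp_mono.
Qed.

Lemma top_coef p m c : top p m c -> coef m p = c.
Proof.
move=> tp; have := tp m; rewrite coefB coefZ coef_mono eqxx mulr1 ltxx.
by case: eqVneq => [/eqP|_ /(_ isT) //]; rewrite subr_eq0 => /eqP.
Qed.

Lemma top_uniq p m c m' c' : top p m c -> top p m' c' -> c != 0 -> c' != 0 ->
  m = m' /\ c = c'.
Proof.
move=> tp tp' c0 c'0; suff e : m = m'.
  by split=> //; rewrite -(top_coef tp) -(top_coef tp') e.
by apply: le_anti; rewrite (top_supp tp') ?(top_supp tp)
  ?(top_coef tp) ?(top_coef tp').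
Qed.

Lemma topZ e p m c : top p m c -> top (e *: p) m (e * c).
Proof. by move=> tp; rewrite /top -scalerA -scalerBr; apply: suppZ. Qed.

Lemma topD p m c q : top p m c -> below m q -> top (p + q) m c.
Proof. by move=> tp bq; rewrite /top addrAC; apply: suppD. Qed.

(** A linear map that is strictly increasing on leading words of monomials is
    determined on leading terms: the images of the smaller words stay smaller. *)
Lemma top_linear (f : A -> A) (phi : word X -> word X) (k : word X -> K) p m c :
  linear f -> (forall u v, (u < v)%O -> (phi u < phi v)%O) ->
  (forall w, top (f (mono w)) (phi w) (k w)) ->
  top p m c -> top (f p) (phi m) (c * k m).
Proof.
move=> lf phi_lt tf tp.
rewrite -(subrK (c *: mono m) p) addrC (lin_add lf) (lin_scalable lf).
apply: topD; first exact/topZ/tf.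
apply: (supp_linear lf tp) => w /phi_lt wm.
by apply: suppW (top_supp (tf w)) => v /le_lt_trans; apply.
Qed.

Lemma top_linear_mono (f : A -> A) (phi : word X -> word X) p m c :
  linear f -> (forall u v, (u < v)%O -> (phi u < phi v)%O) ->
  (forall w, f (mono w) = mono (phi w)) -> top p m c -> top (f p) (phi m) c.
Proof.
move=> lf phi_lt ef tp; rewrite -[c]mulr1.
apply: (top_linear (k := fun=> 1)) => // w; rewrite ef; exact: top_mono.
Qed.

Lemma top_mull w p m c : top p m c -> top (mono w ** p) (wcat w m) c.
Proof.
apply: (@top_linear_mono (mul (mono w)) (wcat w)) => [|u v|u].
- exact: mulr_linear.
- by rewrite ltw_cat2l.
- by rewrite mul_mono.
Qed.

Lemma top_mulr w p m c : top p m c -> top (p ** mono w) (wcat m w) c.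
Proof.
apply: (@top_linear_mono (fun p => p ** mono w) (fun v => wcat v w)) => [|u v|u].
- exact: mull_linear.
- by rewrite ltw_cat2r.
- by rewrite mul_mono.
Qed.

Local Notation dern i p := (iter i der p).

Lemma dern_linear i : linear (fun p : A => dern i p).
Proof.
by elim: i => //= i ih a p q; rewrite ih der_linear.
Qed.

Lemma dern_letter i j g :
  dern i (mono (Single (Der j g))) = mono (Single (Der (i + j) g)) :> A.
Proof. by elim: i => //= i ->; rewrite der_letter. Qed.

Lemma dern_op_linear i : linear (fun p : A => dern i (op p)).
Proof. by move=> a p q; rewrite op_linear dern_linear. Qed.

Lemma dern_op_mono i w : dern i (op (mono w)) = mono (opw i w) :> A.
Proof. by rewrite op_mono dern_letter addn0. Qed.

Lemma top_op i p m c : top p m c -> top (dern i (op p)) (opw i m) c.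
Proof.
apply: (@top_linear_mono (fun p => dern i (op p)) (opw i)) => [|u v|u].
- exact: dern_op_linear.
- by rewrite ltw_opw.
- by rewrite dern_op_mono.
Qed.

Definition inc (l : letter X) := let: Der i g := l in Der i.+1 g.

(** The leading word of [der (mono w)].  All the words occurring in the derivative
    have the degree and breadth of [w], so letters are compared from the left:
    the first letter gets differentiated, and the others too when the product
    of derivatives comes with the nonzero coefficient [lambda]. *)
Fixpoint dword w :=
  match w with
  | Single l => Single (inc l)
  | Cons l w' => Cons (inc l) (if lambda == 0 then w' else dword w')
  end.

(** The leading coefficient of [der (mono w)]. *)
Fixpoint dcoef w : K :=
  if w is Cons _ w' then (if lambda == 0 then 1 else lambda * dcoef w') else 1.

Lemma dcoef_neq0 w : dcoef w != 0.
Proof.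
elim: w => [l|l w ih] /=; first exact: oner_neq0.
by case: (eqVneq lambda 0) => [_|l0]; [exact: oner_neq0 | exact: mulf_neq0].
Qed.

Lemma letter_lt_inc l : letter_lt l (inc l).
Proof. by case: l => i g /=; rewrite lexn_diag /lexn ltnSn. Qed.

Lemma letter_lt_inc2 l l' : letter_lt (inc l) (inc l') = letter_lt l l'.
Proof. by case: l l' => i g [j h]. Qed.

Lemma inc_inj : injective inc.
Proof. by case=> i g [j h] [-> ->]. Qed.

Lemma deg_inc l : deg_letter (inc l) = deg_letter l.
Proof. by case: l. Qed.

Lemma deg_dword w : deg (dword w) = deg w.
Proof.
by elim: w => [l|l w ih] /=; rewrite deg_inc //; case: (lambda =P 0); rewrite ?ih.
Qed.

Lemma bre_dword w : bre (dword w) = bre w.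
Proof. by elim: w => [l|l w ih] //=; case: (lambda =P 0); rewrite ?ih. Qed.

Lemma letters_lt_dword u v : letters_lt (dword u) (dword v) = letters_lt u v.
Proof.
elim: u v => [l|l u ih] [l'|l' v] //=; rewrite letter_lt_inc2 ?(inj_eq inc_inj) //.
by case: (lambda =P 0) => // _; rewrite ih.
Qed.

Lemma ltw_dword u v : (dword u < dword v)%O = (u < v)%O.
Proof.
by rewrite !wltE /word_lt /deg_bre_lex !deg_dword !bre_dword letters_lt_dword.
Qed.

Lemma dword_cat u v :
  dword (wcat u v) = wcat (dword u) (if lambda == 0 then v else dword v).
Proof. by elim: u => [l|l u ih] //=; rewrite ih; case: (lambda =P 0). Qed.

Lemma ltw_cat_dword_l u v w : deg v = deg w -> bre v = bre w ->
  (wcat u v < wcat (dword u) w)%O.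
Proof.
move=> dvw bvw; rewrite wltE /word_lt /deg_bre_lex !deg_cat deg_dword dvw.
rewrite !bre_cat bre_dword bvw !lexn_diag.
by case: u => [l|l u] /=; rewrite letter_lt_inc.
Qed.

Lemma ltw_self_dword w : (w < dword w)%O.
Proof.
rewrite wltE /word_lt /deg_bre_lex deg_dword bre_dword !lexn_diag.
by case: w => [l|l w] /=; rewrite letter_lt_inc.
Qed.

(** The three terms of the Leibniz rule for [uv] have leading words at most that
    of [der (uv)]; the one where the left factor is not derived is strictly
    smaller. *)
Lemma lew_dword2 u v : lambda != 0 ->
  (wcat (dword u) (dword v) <= dword (wcat u v))%O.
Proof. by move=> l0; rewrite dword_cat (negPf l0). Qed.

Lemma lew_dword_l u v : (wcat (dword u) v <= dword (wcat u v))%O.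
Proof.
rewrite dword_cat; case: (lambda =P 0) => // _; rewrite lew_cat2l.
exact/ltW/ltw_self_dword.
Qed.

Lemma ltw_dword_r u v : (wcat u (dword v) < dword (wcat u v))%O.
Proof.
rewrite dword_cat; apply: ltw_cat_dword_l.
  by case: (lambda =P 0); rewrite deg_dword.
by case: (lambda =P 0); rewrite bre_dword.
Qed.

(** As [lambda] occurs in the type of [p], an equation [lambda = 0] cannot be
    substituted in place. *)
Lemma scale_eq0 c p : c = 0 -> c *: p = 0.
Proof. by move=> ->; rewrite scale0r. Qed.

Lemma top_der_mono w : top (der (mono w)) (dword w) (dcoef w).
Proof.
elim: w => [[i g]|l w ih]; first by rewrite der_letter; apply: top_mono.
rewrite der_word.
have -> : der (mono (Single l)) = mono (Single (inc l)) :> A.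
  by case: l => i g; rewrite der_letter.
have last_below : below (dword (Cons l w)) (mono (Single l) ** der (mono w)).
  apply: suppW (top_supp (top_mull (w := Single l) ih)) => v /le_lt_trans; apply.
  exact: (ltw_dword_r (Single l)).
rewrite mul_mono /= in last_below *.
case: (eqVneq lambda 0) last_below => [l0 | l0] lb.
  by rewrite scale_eq0 // add0r; apply: topD lb; apply: top_mono.
rewrite -addrA; apply: topD.
  exact/topZ/(top_mull (w := Single (inc l)) ih).
apply: suppD lb; apply: supp_mono; rewrite (ltw_cat2l (Single _)).
exact: ltw_self_dword.
Qed.

Lemma top_der p m c : top p m c -> top (der p) (dword m) (c * dcoef m).
Proof.
apply: top_linear; first exact: der_linear.
  by move=> u v; rewrite ltw_dword.
exact: top_der_mono.
Qed.

(** The factor by which an iterated derivation multiplies the leading coefficient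
    depends on the leading word alone. *)
Lemma top_dern i : exists2 k : word X -> K, forall w, k w != 0 &
  forall p m c, top p m c -> top (dern i p) (iter i dword m) (c * k m).
Proof.
elim: i => [|i [k k0 tk]].
  by exists (fun=> 1) => [w|p m c]; rewrite ?oner_neq0 ?mulr1.
exists (fun w => k w * dcoef (iter i dword w)) => [w|p m c tp].
  by rewrite mulf_neq0 ?dcoef_neq0.
by rewrite mulrA; apply/top_der/tk.
Qed.

Lemma bre_dwordn i w : bre (iter i dword w) = bre w.
Proof. by elim: i => //= i; rewrite bre_dword. Qed.

End Leading.

Arguments dword {K d X} lambda w.
Arguments top_mono {K d X lambda} A w.

(** * Normal words and the polynomials they span *)

Section Span.
Variables (K : fieldType) (V : lmodType K).
Implicit Types (S T : V -> Prop) (p q : V) (a : K).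

Inductive span S : V -> Prop :=
  | span0 : span S 0
  | span_cons a p q of S p & span S q : span S (a *: p + q).

Lemma span_gen S p : S p -> span S p.
Proof.
by move=> Sp; rewrite -[p]scale1r -[_ *: p]addr0; apply: span_cons (span0 _).
Qed.

Lemma spanD S p q : span S p -> span S q -> span S (p + q).
Proof.
move=> Sp Sq; elim: {p} Sp => [|a p r Sp _ ih]; first by rewrite add0r.
by rewrite -addrA; apply: span_cons.
Qed.

Lemma spanZ S a p : span S p -> span S (a *: p).
Proof.
elim=> [|b {}p r Sp _ ih]; first by rewrite scaler0; apply: span0.
by rewrite scalerDr scalerA; apply: span_cons.
Qed.

Lemma spanN S p : span S p -> span S (- p).
Proof. by rewrite -scaleN1r; apply: spanZ. Qed.

Lemma spanB S p q : span S p -> span S q -> span S (p - q).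
Proof. by move=> Sp Sq; apply: spanD Sp _; apply: spanN. Qed.

Lemma span_linear S T (f : V -> V) p : linear f -> span S p ->
  (forall q, S q -> span T (f q)) -> span T (f p).
Proof.
move=> lf Sp Tf; elim: {p} Sp => [|a p q Sp _ ih].
  by rewrite (lin_0 lf); apply: span0.
by rewrite lf; apply: spanD ih; apply: spanZ; apply: Tf.
Qed.

Lemma spanW S T p : (forall q, S q -> T q) -> span S p -> span T p.
Proof.
by move=> ST Sp; apply: (@span_linear S T id) => // q /ST; apply: span_gen.
Qed.

End Span.

Section NormalWords.
Variables (K : fieldType) (d : Order.disp_t) (X : orderType d) (lambda : K).
Variable A : free_algebra X lambda.
Variable S : A -> Prop.
Implicit Types (p q r s : A) (u v w m : word X) (a b c : K).
Implicit Types (B Q : word X -> Prop).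

Local Notation dern i p := (iter i der p).

(** [normal p m c]: [p] is a normal word [u|_(D^i s)] with leading word [m] and
    leading coefficient [c].  Building the context of the star outwards, without
    a variable for the star, provides induction and inversion on the leading
    word.  A derivative applied directly to the star is absorbed in [i]. *)
Inductive normal : A -> word X -> K -> Prop :=
  | normal_base i s m c of S s & top (dern i s) m c & c != 0 :
      normal (dern i s) m c
  | normal_op i p m c of normal p m c : normal (dern i (op p)) (opw i m) c
  | normal_mull w p m c of normal p m c : normal (mono w ** p) (wcat w m) c
  | normal_mulr w p m c of normal p m c : normal (p ** mono w) (wcat m w) c.

Lemma normal_top p m c : normal p m c -> top p m c /\ c != 0.
Proof.
elim=> {p m c} [//|i p m c _ [tp c0]|w p m c _ [tp c0]|w p m c _ [tp c0]].
- by split=> //; apply: top_op.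
- by split=> //; apply: top_mull.
- by split=> //; apply: top_mulr.
Qed.

(** The span of the normal words whose leading words satisfy [B]; with
    [B = (< w)] this is congruence to [0] modulo [S] and [w]. *)
Definition reducible B : A -> Prop :=
  span (fun q => exists m c, normal q m c /\ B m).

Lemma redW B Q p : (forall w, B w -> Q w) -> reducible B p -> reducible Q p.
Proof.
by move=> BQ; apply: spanW => q [m [c [nq Bm]]]; exists m, c; split; auto.
Qed.

Lemma red_normal B p m c : normal p m c -> B m -> reducible B p.
Proof. by move=> np Bm; apply: span_gen; exists m, c. Qed.

Lemma red_linear B Q f p : linear f -> reducible B p ->
  (forall q m c, normal q m c -> B m -> reducible Q (f q)) -> reducible Q (f p).
Proof.
move=> lf Bp fQ; apply: (span_linear lf Bp) => q [m [c [nq Bm]]].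
exact: fQ nq Bm.
Qed.

Lemma red_op B Q i p : reducible B p -> (forall m, B m -> Q (opw i m)) ->
  reducible Q (dern i (op p)).
Proof.
move=> Bp BQ; apply: (red_linear (dern_op_linear (A := A) i) Bp) => q m c nq Bm.
by apply: (red_normal (normal_op i nq)); apply: BQ.
Qed.

Lemma red_supp B Q f p : linear f -> supp B p ->
  (forall w, B w -> reducible Q (f (mono w))) -> reducible Q (f p).
Proof.
move=> lf Bp fQ.
apply: (supp_ind (R := fun p => reducible Q (f p)) Bp) => [|c w q Bw ih].
  by rewrite (lin_0 lf); apply: span0.
by rewrite lf; apply: spanD ih; apply: spanZ; apply: fQ.
Qed.

Lemma red_mull B B' Q p q : supp B p -> reducible B' q ->
  (forall u v, B u -> B' v -> Q (wcat u v)) -> reducible Q (p ** q).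
Proof.
move=> Bp Bq BQ; apply: (red_supp (mull_linear q) Bp) => u Bu.
apply: (red_linear (mulr_linear (mono u)) Bq) => r m c nr Bm.
by apply: (red_normal (normal_mull u nr)); apply: BQ.
Qed.

Lemma red_mulr B B' Q p q : reducible B p -> supp B' q ->
  (forall u v, B u -> B' v -> Q (wcat u v)) -> reducible Q (p ** q).
Proof.
move=> Bp Bq BQ; apply: (red_supp (mulr_linear p) Bq) => v Bv.
apply: (red_linear (mull_linear (mono v)) Bp) => r m c nr Bm.
by apply: (red_normal (normal_mulr v nr)); apply: BQ.
Qed.

Definition redlt w := reducible (fun v => (v < w)%O).
Definition redle w := reducible (fun v => (v <= w)%O).

Lemma supp_der_mono w :
  supp (fun v => (v <= dword lambda w)%O) (der (mono w) : A).
Proof. exact: (top_supp (@top_der_mono _ _ _ _ A w)). Qed.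

(** The span of the normal words is stable under derivation, with the same control
    of leading words as for a single polynomial: the Leibniz rule splits the
    derivative of a product, and each term has a bounded leading word.  In the
    base case, a derived relation stays a derived relation. *)
Lemma red_der_normal p m c : normal p m c -> redle (dword lambda m) (der p).
Proof.
elim=> {p m c} [i s m c Ss ts c0|i p m c np _|w p m c np ih|w p m c np ih].
- have ts' := top_der ts.
  apply: (red_normal (m := dword lambda m) (c := c * dcoef lambda m)) => //.
  rewrite -[der (iter i der s)]/(dern i.+1 s).
  by apply: normal_base => //; rewrite mulf_neq0 ?dcoef_neq0.
- exact: (red_normal (normal_op i.+1 np)).
- have tw := @supp_der_mono w; have rp : redle m p by apply: red_normal np _.
  rewrite derM; apply: spanD; first apply: spanD.
  + have [l0|l0] := eqVneq lambda 0.
      by rewrite scale_eq0 //; apply: span0.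
    apply: spanZ; apply: (red_mull tw ih) => u v uw vm.
    exact: le_trans (wcat_le uw vm) (lew_dword2 _ _ l0).
  + apply: (red_mull tw rp) => u v uw vm.
    exact: le_trans (wcat_le uw vm) (lew_dword_l _ _ _).
  + apply: (red_mull (supp_mono (Q := eq w) erefl) ih) => _ v <- vm.
    by apply/ltW/(le_lt_trans _ (ltw_dword_r _ _ _)); rewrite lew_cat2l.
- have tw := @supp_der_mono w; have rp : redle m p by apply: red_normal np _.
  rewrite derM; apply: spanD; first apply: spanD.
  + have [l0|l0] := eqVneq lambda 0.
      by rewrite scale_eq0 //; apply: span0.
    apply: spanZ; apply: (red_mulr ih tw) => u v um vw.
    exact: le_trans (wcat_le um vw) (lew_dword2 _ _ l0).
  + apply: (red_mulr ih (supp_mono (Q := eq w) erefl)) => u _ um <-.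
    by apply: (le_trans _ (lew_dword_l _ _ _)); rewrite lew_cat2r.
  + apply: (red_mulr rp tw) => u v um vw.
    exact/ltW/(le_lt_trans (wcat_le um vw))/ltw_dword_r.
Qed.

Lemma red_der B Q p : reducible B p ->
  (forall m n, B m -> (n <= dword lambda m)%O -> Q n) -> reducible Q (der p).
Proof.
move=> Bp BQ; apply: (red_linear (der_linear (f := A)) Bp) => q m c nq Bm.
by apply: redW (red_der_normal nq) => n; apply: BQ.
Qed.

Lemma redlt_der w p : redlt w p -> redlt (dword lambda w) (der p).
Proof.
move=> wp; apply: (red_der wp) => m n mw /le_lt_trans; apply.
by rewrite ltw_dword.
Qed.

(** Derivation preserves the degree, which the order compares before all else:
    polynomials of smaller degree may be derived freely. *)
Lemma red_dern_deg n i p : reducible (fun m => deg m <= n)%N p ->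
  reducible (fun m => deg m <= n)%N (dern i p).
Proof.
move=> np; elim: i => //= i ih; apply: (red_der ih) => m v mn /lew_deg.
by rewrite deg_dword => /leq_trans; apply.
Qed.

Lemma supp_dern_deg n i p : supp (fun m => deg m <= n)%N p ->
  supp (fun m => deg m <= n)%N (dern i p).
Proof.
move=> np; elim: i => //= i ih.
apply: (supp_linear (@der_linear _ _ _ A) ih) => w wn.
apply: suppW (@supp_der_mono w) => v /lew_deg.
by rewrite deg_dword => /leq_trans; apply.
Qed.

(** What the resolution of compositions retains of a normal word with leading word
    [w], once made monic. *)
Definition reduct w p := redle w p /\ below w (mono w - p).

Lemma normal_reduct p m c : normal p m c -> reduct m (c^-1 *: p).
Proof.
move=> np; have [tp c0] := normal_top np; split.
  by apply: spanZ; apply: red_normal np _.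
have := topZ (e := c^-1) tp; rewrite /top mulVf // scale1r => /suppN.
by rewrite opprB.
Qed.

End NormalWords.

(** * The relations and their compositions inside one factor *)

Section RotaBaxter.
Variables (K : fieldType) (d : Order.disp_t) (X : orderType d) (lambda : K).
Variable A : free_algebra X lambda.
Implicit Types (p q r s : A) (u v w m z : word X) (a b c : K).
Implicit Types (B Q : word X -> Prop).

Local Notation dern i p := (iter i der p).

Definition rb_defect p q : A :=
  op p ** op q - op (p ** op q) - op (op p ** q) - lambda *: op (p ** q).

Definition dp_defect p : A := der (op p) - p.

Inductive relations : A -> Prop :=
  | rb_relation u v : relations (rb_defect (mono u) (mono v))
  | dp_relation u : relations (dp_defect (mono u)).

Local Notation normal := (normal relations).
Local Notation redlt := (redlt relations).
Local Notation redle := (redle relations).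
Local Notation reducible := (reducible relations).
Local Notation reduct := (reduct relations).

Lemma rb_defect_linearl q : linear (rb_defect^~ q).
Proof.
move=> a p r; rewrite /rb_defect !(opD, opZ, mulDl, mulZl).
by linear_identity.
Qed.

Lemma rb_defect_linearr p : linear (rb_defect p).
Proof.
move=> a q r; rewrite /rb_defect !(opD, opZ, mulDr, mulZr).
by linear_identity.
Qed.

Lemma dern_dp_defect i p : dern i (dp_defect p) = dern i.+1 (op p) - dern i p.
Proof. by rewrite /dp_defect (lin_sub (dern_linear (A := A) i)) -iterSr. Qed.

Lemma dern_dp_defect_linear i : linear (fun p => dern i (dp_defect p)).
Proof.
move=> a p q; rewrite !dern_dp_defect /= dern_op_linear der_linear dern_linear.
by linear_identity.
Qed.

Lemma deg_opw i u : deg (opw i u) = (deg u).+1.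
Proof. by []. Qed.

Lemma top_dp_defect i u : top (dern i (dp_defect (mono u))) (opw i.+1 u) 1.
Proof.
rewrite dern_dp_defect; apply: topD.
  exact/(@top_op _ _ _ _ _ i.+1)/top_mono.
apply: suppN; apply: (suppW (Q := fun v => (deg v <= deg u)%N)).
  by move=> v vu; apply: wlt_deg.
by apply: supp_dern_deg; apply: supp_mono.
Qed.

Lemma normal_dp_defect i u : normal (dern i (dp_defect (mono u))) (opw i.+1 u) 1.
Proof.
apply: normal_base; [exact: dp_relation|exact: top_dp_defect|exact: oner_neq0].
Qed.

Lemma red_dp_defect B Q i p : supp B p -> (forall u, B u -> Q (opw i.+1 u)) ->
  reducible Q (dern i (dp_defect p)).
Proof.
move=> Bp BQ; apply: (red_supp (dern_dp_defect_linear i) Bp) => u /BQ Qu.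
exact: (red_normal (normal_dp_defect i u)).
Qed.

(** The middle terms have the same degree as [P(u)P(v)] and lose on breadth; the
    last one loses on degree. *)
Lemma top_rb_defect u v :
  top (rb_defect (mono u) (mono v)) (wcat (opw 0 u) (opw 0 v)) 1.
Proof.
rewrite /rb_defect !op_mono !mul_mono !op_mono.
apply: topD; [apply: topD; [apply: topD; [exact: top_mono|]|]|];
  apply: suppN; try apply: suppZ.
- apply: supp_mono; apply: wlt_bre => //=.
  by rewrite deg_cat addSn.
- apply: supp_mono; apply: wlt_bre => //=.
  by rewrite addnS.
- apply: supp_mono; apply: wlt_deg => //=.
  by rewrite deg_cat addSn addnS ltnS.
Qed.

Lemma normal_rb_defect u v :
  normal (rb_defect (mono u) (mono v)) (wcat (opw 0 u) (opw 0 v)) 1.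
Proof.
apply: (normal_base (i := 0)); first exact: rb_relation.
  exact: top_rb_defect.
exact: oner_neq0.
Qed.

Lemma red_rb_defect B B' Q p q : supp B p -> supp B' q ->
  (forall u v, B u -> B' v -> Q (wcat (opw 0 u) (opw 0 v))) ->
  reducible Q (rb_defect p q).
Proof.
move=> Bp Bq BQ; apply: (red_supp (rb_defect_linearl q) Bp) => u Bu.
apply: (red_supp (rb_defect_linearr (mono u)) Bq) => v Bv.
exact: (red_normal (normal_rb_defect u v) (BQ _ _ Bu Bv)).
Qed.

Lemma red_below w p : redlt w p -> below w p.
Proof.
elim=> [|a q r [m [c [nq mw]]] _ ih]; first exact: supp0.
apply: suppD ih; apply: suppZ; have [tq _] := normal_top nq.
by apply: suppW (top_supp tq) => v /le_lt_trans; apply.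
Qed.

Lemma reduct_deg n i w p : reduct w p -> (deg w <= n)%N ->
  reducible (fun v => deg v <= n)%N (dern i p).
Proof.
case=> pw _ wn; apply: red_dern_deg; apply: redW pw => v /lew_deg.
by move=> vw; apply: leq_trans wn.
Qed.

(** Rewriting [u] by [p] inside [D^(i+1)(P(u))] and collapsing [D(P(u))] to [u]
    commute: collapse the smaller words of [p] as well, and what is left,
    [D^i(p)], is reducible of smaller degree. *)
Lemma dp_composition i u p : reduct u p ->
  redlt (opw i.+1 u) (dern i (dp_defect (mono u)) - dern i.+1 (op p)).
Proof.
move=> up; have [_ pu] := up.
have -> : dern i (dp_defect (mono u)) - dern i.+1 (op p) =
          dern i (dp_defect (mono u - p)) - dern i p.
  rewrite (lin_sub (dern_dp_defect_linear i)).
  rewrite [dern i (dp_defect p)]dern_dp_defect.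
  by linear_identity.
apply: spanB; first by apply: (red_dp_defect pu) => v; rewrite ltw_opw.
by apply: redW (reduct_deg i up (leqnn _)) => v vu; apply: wlt_deg.
Qed.

(** Two relations placed side by side do not interact: rewriting the left factor of
    [D^(i+1)(P(u)) z] to [D^i(u)] and its right factor [z] by [q] can be done in
    either order, and both orders lead to [D^i(u) q], of smaller degree. *)
Lemma dp_mul_composition i u z q : reduct z q ->
  redlt (wcat (opw i.+1 u) z)
    (dern i (dp_defect (mono u)) ** mono z - mono (opw i.+1 u) ** q).
Proof.
move=> zq; have [qz qzb] := zq.
have -> : dern i (dp_defect (mono u)) ** mono z - mono (opw i.+1 u) ** q =
  dern i (dp_defect (mono u)) ** (mono z - q) - dern i (mono u) ** q.
  by rewrite dern_dp_defect dern_op_mono !(mulBl, mulBr); linear_identity.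
apply: spanB.
  have ng := red_normal (B := eq (opw i.+1 u)) (normal_dp_defect i u) erefl.
  apply: (red_mulr ng qzb).
  by move=> _ v <- vz; rewrite ltw_cat2l.
have du : supp (fun v => deg v <= deg u)%N (dern i (mono u) : A).
  by apply: supp_dern_deg; apply: supp_mono.
apply: (red_mull du qz) => v v' vu vz.
by apply: wcat_ltle vz; apply: wlt_deg.
Qed.

End RotaBaxter.

Arguments top_rb_defect {K d X lambda} A u v.
Arguments top_dp_defect {K d X lambda} A i u.

(** * Resolution of the compositions *)

Section Compositions.
Variables (K : fieldType) (d : Order.disp_t) (X : orderType d) (lambda : K).
Variable A : free_algebra X lambda.
Implicit Types (p q r s f g : A) (u v w m z : word X) (a b c : K).
Implicit Types (B Q : word X -> Prop).

Local Notation dern i p := (iter i der p).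
Local Notation relations := (@relations K d X lambda A).
Local Notation normal := (normal relations).
Local Notation redlt := (redlt relations).
Local Notation redle := (redle relations).
Local Notation reducible := (reducible relations).
Local Notation reduct := (reduct relations).

(** The number of derivatives on the second letter of the leading word of the [i]-th
    derivative of a product of two letters. *)
Definition tail_order (i : nat) : nat := if lambda == 0 then 0%N else i.

Definition rbword i u v : word X := wcat (opw i u) (opw (tail_order i) v).

Lemma dword_rbword i u v : dword lambda (rbword i u v) = rbword i.+1 u v.
Proof. by rewrite /rbword /tail_order /=; case: eqP. Qed.

Lemma top_dern_rb_defect i u v :
  exists2 c, c != 0 &
    top (dern i (rb_defect (mono u) (mono v)) : A) (rbword i u v) c.
Proof.
have [k k0 tk] := top_dern A i; have tc := tk _ _ _ (top_rb_defect A u v).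
rewrite mul1r in tc; exists (k (wcat (opw 0 u) (opw 0 v))) => //.
suff -> : rbword i u v =
    iter i (dword lambda) (wcat (opw 0 u) (opw 0 v)) by [].
elim: {k k0 tk tc} i => [|i ih]; first by rewrite /rbword /tail_order; case: eqP.
by rewrite iterS -ih dword_rbword.
Qed.

Lemma redle_op i u p : redle u p -> redle (opw i u) (dern i (op p)).
Proof. by move=> up; apply: (red_op up) => m; rewrite lew_opw. Qed.

Lemma redlt_op i u w p : redle u p -> (opw i u < w)%O ->
  redlt w (dern i (op p)).
Proof.
move=> up uw; apply: redW (redle_op i up) => v /le_lt_trans; exact.
Qed.

Lemma supp_op_mono u : supp (eq (opw 0 u)) (op (mono u) : A).
Proof. by rewrite op_mono; apply: supp_mono. Qed.

Lemma ltw_rb0 u v : (opw 0 (wcat u v) < rbword 0 u v)%O.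
Proof. by apply: wlt_deg; rewrite /= deg_cat addnS addSn. Qed.

Lemma rbword0 u v : rbword 0 u v = wcat (opw 0 u) (opw 0 v).
Proof. by rewrite /rbword /tail_order; case: eqP. Qed.

Lemma ltw_rb_l u v : (opw 0 (wcat (opw 0 u) v) < rbword 0 u v)%O.
Proof. by rewrite rbword0; apply: wlt_bre => //=; rewrite addnS. Qed.

Lemma ltw_rb_r u v : (opw 0 (wcat u (opw 0 v)) < rbword 0 u v)%O.
Proof. by rewrite rbword0; apply: wlt_bre => //=; rewrite deg_cat addSn. Qed.

(** Applying the Rota-Baxter relation to all the words of [p], the leading one
    included, turns [P(p)P(v)] into values of [P] on products with the reducible
    factor [p]. *)
Lemma rb_composition_l u v p : reduct u p ->
  redlt (rbword 0 u v) (rb_defect (mono u) (mono v) - op p ** op (mono v)).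
Proof.
case=> up pu.
have -> : rb_defect (mono u) (mono v) - op p ** op (mono v) =
    rb_defect (mono u - p) (mono v) - op (p ** op (mono v))
    - op (op p ** mono v) - lambda *: op (p ** mono v) :> A.
  rewrite (lin_sub (rb_defect_linearl (mono v))) {2}/rb_defect; linear_identity.
have eqv : supp (eq v) (mono v : A) by apply: supp_mono.
apply: spanB; [apply: spanB; [apply: spanB|]|].
- apply: (red_rb_defect pu eqv) => u' _ u'u <-.
  by rewrite rbword0 ltw_cat2r ltw_opw.
- apply: (redlt_op (i := 0)) (ltw_rb_r u v).
  by apply: (red_mulr up (@supp_op_mono v)) => u' _ u'u <-; rewrite lew_cat2r.
- apply: (redlt_op (i := 0)) (ltw_rb_l u v).
  apply: (red_mulr (redle_op 0 up) eqv) => u' _ u'u <-.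
  by rewrite lew_cat2r.
- apply: spanZ; apply: (redlt_op (i := 0)) (ltw_rb0 u v).
  by apply: (red_mulr up eqv) => u' _ u'u <-; rewrite lew_cat2r.
Qed.

Lemma rb_composition_r u v p : reduct v p ->
  redlt (rbword 0 u v) (rb_defect (mono u) (mono v) - op (mono u) ** op p).
Proof.
case=> vp pv.
have -> : rb_defect (mono u) (mono v) - op (mono u) ** op p =
    rb_defect (mono u) (mono v - p) - op (mono u ** op p)
    - op (op (mono u) ** p) - lambda *: op (mono u ** p) :> A.
  rewrite (lin_sub (rb_defect_linearr (mono u))) {2}/rb_defect; linear_identity.
have equ : supp (eq u) (mono u : A) by apply: supp_mono.
apply: spanB; [apply: spanB; [apply: spanB|]|].
- apply: (red_rb_defect equ pv) => _ v' <- v'v.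
  by rewrite rbword0 ltw_cat2l ltw_opw.
- apply: (redlt_op (i := 0)) (ltw_rb_r u v).
  by apply: (red_mull equ (redle_op 0 vp)) => _ v' <- v'v; rewrite lew_cat2l.
- apply: (redlt_op (i := 0)) (ltw_rb_l u v).
  apply: (red_mull (@supp_op_mono u) vp) => _ v' <- v'v.
  by rewrite lew_cat2l.
- apply: spanZ; apply: (redlt_op (i := 0)) (ltw_rb0 u v).
  by apply: (red_mull equ vp) => _ v' <- v'v; rewrite lew_cat2l.
Qed.

(** Up to defects, [P(p)P(q)] is [P] of the product [p P(q) + P(p) q + lambda p q],
    which is itself associative up to defects; so the two ways of rewriting
    [P(p)P(q)P(r)] differ by defects only. *)
Lemma rb_assoc p q r :
  rb_defect p q ** op r - op p ** rb_defect q r =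
  rb_defect p (q ** op r) + rb_defect p (op q ** r)
  + lambda *: rb_defect p (q ** r)
  - rb_defect (p ** op q) r - rb_defect (op p ** q) r
  - lambda *: rb_defect (p ** q) r
  + op (rb_defect p q ** r) - op (p ** rb_defect q r) :> A.
Proof.
rewrite /rb_defect.
rewrite !(mulDl, mulDr, mulBl, mulBr, mulOppl, mulOppr, mulZl, mulZr).
rewrite !(opB, opD, opN, opZ) !mulA; linear_identity.
Qed.

Lemma rb_intersection u v w :
  redlt (wcat (wcat (opw 0 u) (opw 0 v)) (opw 0 w))
    (rb_defect (mono u) (mono v) ** op (mono w)
     - op (mono u) ** rb_defect (mono v) (mono w)).
Proof.
set W := wcat _ _; rewrite rb_assoc.
have two u' v' : (deg u' + deg v' <= (deg u + deg v + deg w).+1)%N ->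
    redlt W (rb_defect (mono u') (mono v')).
  move=> le_deg; apply: (red_normal (normal_rb_defect A u' v')).
  have : (deg (wcat (opw 0 u') (opw 0 v')) <= deg W)%N.
    by rewrite /W !deg_cat !deg_opw; lia.
  rewrite leq_eqVlt => /predU1P[eq_deg|]; last exact: wlt_deg.
  exact: wlt_bre.
have degW : deg W = (deg u + deg v + deg w).+3.
  by rewrite /W !deg_cat !deg_opw; lia.
rewrite !op_mono !mul_mono.
apply: spanB; first apply: spanD; first apply: spanB; first apply: spanB;
  first apply: spanB; first apply: spanD; first apply: spanD.
- by apply: two; rewrite deg_cat deg_opw; lia.
- by apply: two; rewrite deg_cat deg_opw; lia.
- by apply/spanZ/two; rewrite deg_cat; lia.
- by apply: two; rewrite deg_cat deg_opw; lia.
- by apply: two; rewrite deg_cat deg_opw; lia.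
- by apply/spanZ/two; rewrite deg_cat; lia.
- apply: (redlt_op (i := 0) (u := wcat (wcat (opw 0 u) (opw 0 v)) w)).
    exact: (red_normal (normal_mulr w (normal_rb_defect A u v))).
  by apply: wlt_bre => //; rewrite degW deg_opw !deg_cat !deg_opw; lia.
- apply: (redlt_op (i := 0) (u := wcat u (wcat (opw 0 v) (opw 0 w)))).
    exact: (red_normal (normal_mull u (normal_rb_defect A v w))).
  by apply: wlt_bre => //; rewrite degW deg_opw !deg_cat !deg_opw; lia.
Qed.

(** Modulo [D P = id], [D] turns [F(p,q)] into
    [lambda p q + p P(q) + P(p) q - p P(q) - P(p) q - lambda p q = 0]. *)
Lemma der_rb_defect p q : der (rb_defect p q) =
  dp_defect p ** op q + lambda *: (dp_defect p ** der (op q))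
  + op p ** dp_defect q + lambda *: (p ** dp_defect q)
  - dp_defect (p ** op q) - dp_defect (op p ** q)
  - lambda *: dp_defect (p ** q).
Proof.
rewrite /rb_defect /dp_defect !(derB, derZ) derM.
rewrite !(mulDl, mulDr, mulBl, mulBr, mulOppl, mulOppr, mulZl, mulZr).
by linear_identity.
Qed.

(** A monic normal word with the same leading word as the derivative of order [i.+1]
    of [rb_defect (mono u) (mono v)], namely [rbword i.+1 u v]. *)
Definition dpmul i u v : A :=
  dern i (dp_defect (mono u)) ** mono (opw (tail_order i.+1) v).

Lemma tail_order_eq0 i : lambda = 0 -> tail_order i = 0%N.
Proof. by rewrite /tail_order => /eqP ->. Qed.

Lemma tail_order_neq0 i : lambda != 0 -> tail_order i = i.
Proof. by rewrite /tail_order => /negPf ->. Qed.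

(** A derived Rota-Baxter relation follows from the relations [D(P(u)) = u], and only
    one of the normal words that express it reaches its leading word.  Deriving
    such an expression preserves this: the largest of the Leibniz terms of the
    derivative of [dpmul] is the next [dpmul]. *)
Lemma dern_rb_defect i u v : exists2 c, c != 0 &
  redlt (rbword i.+1 u v)
    (dern i.+1 (rb_defect (mono u) (mono v)) - c *: dpmul i u v).
Proof.
elim: i => [|i [c c0 ih]].
  set W := rbword 1 u v.
  have W1 : W = dword lambda (wcat (opw 0 u) (opw 0 v)).
    by rewrite -rbword0 dword_rbword.
  (* the terms of [der_rb_defect] whose first factor is not the defect of [u] *)
  set rest := op (mono u) ** dp_defect (mono v)
    + lambda *: (mono u ** dp_defect (mono v))
    - dp_defect (mono u ** op (mono v)) - dp_defect (op (mono u) ** mono v)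
    - lambda *: dp_defect (mono u ** mono v) : A.
  have rest_small : redlt W rest.
    rewrite /rest !op_mono !mul_mono.
    apply: spanB; first apply: spanB; first apply: spanB; first apply: spanD.
    - apply: (red_normal (normal_mull (opw 0 u) (normal_dp_defect A 0 v))).
      by rewrite W1; exact: (ltw_dword_r lambda (opw 0 u) (opw 0 v)).
    - apply/spanZ/(red_normal (normal_mull u (normal_dp_defect A 0 v))).
      by apply: wlt_deg; rewrite W1 deg_dword !deg_cat !deg_opw addSn.
    - apply: (red_normal (normal_dp_defect A 0 _)).
      by apply: wlt_bre; rewrite W1 ?deg_dword ?bre_dword //= deg_cat addSn.
    - apply: (red_normal (normal_dp_defect A 0 _)).
      by apply: wlt_bre; rewrite W1 ?deg_dword ?bre_dword //= addnS.
    - apply/spanZ/(red_normal (normal_dp_defect A 0 _)).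
      by apply: wlt_deg; rewrite W1 deg_dword /= deg_cat addSn addnS.
  change (dern 1 (rb_defect (mono u) (mono v)))
    with (der (rb_defect (mono u) (mono v)) : A).
  rewrite der_rb_defect /dpmul [dern 0 _]/(dp_defect _).
  have [l0|l0] := eqVneq lambda 0.
    exists 1; first exact: oner_neq0.
    rewrite tail_order_eq0 // -(dern_op_mono A 0 v) [dern 0 _]/(op _).
    set g := dp_defect (mono u) in rest rest_small *.
    set x := _ - _ in rest_small *.
    have -> : x = rest + lambda *: (g ** der (op (mono v))).
      by rewrite /x /rest; linear_identity.
    by rewrite [lambda *: _]scale_eq0 // addr0.
  exists lambda => //; rewrite tail_order_neq0 // -(dern_op_mono A 1 v).
  rewrite [dern 1 _]/(der _).
  set x := _ - _.
  have -> : x = rest + dp_defect (mono u) ** op (mono v).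
    by rewrite /x /rest; linear_identity.
  apply: spanD rest_small _; rewrite op_mono.
  apply: (red_normal (normal_mulr (opw 0 v) (normal_dp_defect A 0 u))).
  rewrite /W /rbword tail_order_neq0 // ltw_cat2l.
  exact: (ltw_self_dword lambda).
have dih := redlt_der ih; rewrite dword_rbword in dih.
set g := dern i (dp_defect (mono u)) : A.
set y := mono (opw (tail_order i.+1) v) : A.
have dy : der y = mono (opw (tail_order i.+1).+1 v) by rewrite /y der_letter.
have ng := normal_dp_defect A i u; have ng' := normal_dp_defect A i.+1 u.
have small : redlt (rbword i.+2 u v) (g ** der y).
  rewrite dy; apply: (red_normal (normal_mulr _ ng)).
  rewrite -dword_rbword.
  exact: (ltw_dword_r lambda (opw i.+1 u) (opw (tail_order i.+1) v)).
rewrite derB derZ derM -[der g]/(dern i.+1 (dp_defect (mono u))) in dih.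
rewrite -[der (dern i.+1 _)]/(dern i.+2 _) in dih.
set f := dern i.+2 _ in dih *; set g' := dern i.+1 (dp_defect _) in ng' dih.
rewrite -/y -/g in dih; have [l0|l0] := eqVneq lambda 0.
  exists c => //.
  have -> : dpmul i.+1 u v = g' ** y by rewrite /dpmul /y !tail_order_eq0.
  have -> : f - c *: (g' ** y) = (f - c *: (lambda *: (g' ** der y) + g' ** y
      + g ** der y)) + c *: (g ** der y) + lambda *: (c *: (g' ** der y)).
    by linear_identity.
  apply: spanD; last by rewrite scale_eq0 //; apply: span0.
  by apply: spanD dih _; apply: spanZ.
exists (c * lambda); first exact: mulf_neq0.
have -> : dpmul i.+1 u v = g' ** der y by rewrite /dpmul dy !tail_order_neq0.
have -> : f - (c * lambda) *: (g' ** der y) =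
    (f - c *: (lambda *: (g' ** der y) + g' ** y + g ** der y))
    + c *: (g' ** y) + c *: (g ** der y).
  by linear_identity.
apply: spanD; first apply: spanD dih _; apply: spanZ => //.
apply: (red_normal (normal_mulr _ ng')).
rewrite /rbword !tail_order_neq0 // ltw_cat2l.
exact: (ltw_self_dword lambda).
Qed.

Variant leading_spec f i : word X -> Prop :=
  | LeadingDp u of f = dp_defect (mono u) : leading_spec f i (opw i.+1 u)
  | LeadingRb u v of f = rb_defect (mono u) (mono v) :
      leading_spec f i (rbword i u v).

Lemma relations_top f i w c : relations f -> top (dern i f) w c -> c != 0 ->
  leading_spec f i w.
Proof.
case=> [u v|u] tw c0.
  have [e e0 te] := top_dern_rb_defect i u v.
  by have [-> _] := top_uniq tw te c0 e0; constructor.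
by have [-> _] := top_uniq tw (top_dp_defect A i u) c0 (oner_neq0 _); constructor.
Qed.

Lemma opw_inj i u j v : opw i u = opw j v -> i = j /\ u = v.
Proof. by case=> -> ->. Qed.

Lemma rbword_inj i u v j u' v' : rbword i u v = rbword j u' v' ->
  [/\ i = j, u = u' & v = v'].
Proof. by case=> -> -> _ ->. Qed.

(** A normal word whose leading word is a single letter comes from a relation
    [D(P(u)) - u] or from inside [P], for lack of breadth. *)
Lemma normal_letter n z q c : normal q (opw n z) c ->
  (exists2 i, n = i.+1 & q = dern i (dp_defect (mono z)) /\ c = 1) \/
  (exists2 p, normal p z c & q = dern n (op p)).
Proof.
have [m em] : exists m, m = opw n z by exists (opw n z).
rewrite -em => nq; case: nq em => {q m c}
  [i s m c Ss ts c0|i p m c np|w p m c np|w p m c np] em.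
- left; have := ts; case: (relations_top Ss ts c0) em => [u -> /opw_inj[<- ->]|//].
  move=> /top_coef; rewrite (top_coef (top_dp_defect A i z)) => <-.
  by exists i.
- by right; case: em => -> <-; exists p.
- by case: w em.
- by case: m em {np}.
Qed.

Lemma letter_reduct n z q c : normal q (opw n z) c ->
  (exists2 i, n = i.+1 & c^-1 *: q = dern i (dp_defect (mono z))) \/
  (exists2 p, reduct z p & c^-1 *: q = dern n (op p)).
Proof.
case/normal_letter => [[i -> [-> ->]]|[p np ->]]; [left|right].
  by exists i; rewrite // invr1 scale1r.
exists (c^-1 *: p); first exact: normal_reduct np.
by rewrite (lin_scalable (dern_op_linear (A := A) n)).
Qed.

Lemma normal_two l l' q c : normal q (Cons l (Single l')) c ->
  [\/ exists k s, relations s /\ q = dern k s,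
      exists2 p, normal p (Single l') c & q = mono (Single l) ** p
    | exists2 p, normal p (Single l) c & q = p ** mono (Single l')].
Proof.
have [m em] : exists m, m = Cons l (Single l') by eexists.
rewrite -em => nq; case: nq em => {q m c}
  [i s m c Ss ts c0|i p m c np|w p m c np|w p m c np] em.
- by constructor 1; exists i, s.
- by [].
- constructor 2; exists p; last by case: w em => [l1|l1 [?|? ?]] // [->].
  by case: w em => [l1|l1 [?|? ?]] // [_ <-].
- constructor 3; exists p; first by case: m em np => [l1|l1 [?|? ?]] // [->].
  by case: m em np => [l1|l1 [?|? ?]] // [_ ->].
Qed.

Lemma top_dpmul i u v : top (dpmul i u v) (rbword i.+1 u v) 1.
Proof. by apply: top_mulr; apply: top_dp_defect. Qed.

Lemma dern_rb_defect_lead i u v c :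
  top (dern i.+1 (rb_defect (mono u) (mono v)) : A) (rbword i.+1 u v) c ->
  c != 0 -> redlt (rbword i.+1 u v)
    (c^-1 *: dern i.+1 (rb_defect (mono u) (mono v)) - dpmul i u v).
Proof.
move=> tc c0; have [e e0 small] := dern_rb_defect i u v.
have ce : c = e.
  rewrite -(top_coef tc); apply: top_coef.
  rewrite -(subrK (e *: dpmul i u v) (dern _ _)) addrC.
  apply: topD (red_below small).
  by have := topZ (e := e) (@top_dpmul i u v); rewrite mulr1.
rewrite -ce in small.
have -> : forall p q, c^-1 *: p - q = c^-1 *: (p - c *: q).
  by move=> p q; rewrite scalerBr scalerA mulVf // scale1r.
exact: spanZ.
Qed.

Lemma tail_order0 : tail_order 0 = 0%N.
Proof. by rewrite /tail_order; case: eqP. Qed.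

Lemma coef_rb_defect0 u v c :
  top (dern 0 (rb_defect (mono u) (mono v)) : A) (rbword 0 u v) c -> c = 1.
Proof.
move/top_coef => <-; rewrite rbword0; exact: (top_coef (top_rb_defect A u v)).
Qed.

(** A derived relation is determined by its leading word, so that the compositions of
    two relations at the root are trivial. *)
Lemma relations_lead_inj f g i j w c e : relations f -> relations g ->
  top (dern i f) w c -> top (dern j g) w e -> c != 0 -> e != 0 ->
  dern i f = dern j g.
Proof.
move=> Sf Sg tf tg c0 e0; have := relations_top Sg tg e0.
case: (relations_top Sf tf c0) => [u|u v] -> {f w Sf tf tg}.
  by move em: (opw i.+1 u) => m lead_g; case: lead_g em => [v -> [-> ->]|].
move em: (rbword i u v) => m lead_g; case: lead_g em => [//|u' v' ->].
by case/rbword_inj=> -> -> ->.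
Qed.

(** Inclusion compositions: inverting the position of the inner relation in a leading
    word with one or two letters leaves a composition at the root, in the left
    or in the right factor.  When a Rota-Baxter relation is derived, it is first
    replaced by [dpmul]. *)
Lemma red_including f i w c0 q c :
  relations f -> top (dern i f) w c0 -> c0 != 0 -> normal q w c ->
  redlt w (c0^-1 *: dern i f - c^-1 *: q).
Proof.
move=> Sf tf c00 nq; have [tq cn0] := normal_top nq.
have at_root k s : relations s -> q = dern k s ->
    redlt w (c0^-1 *: dern i f - c^-1 *: q).
  move=> Ss es; rewrite es in tq *.
  have e := relations_lead_inj Sf Ss tf tq c00 cn0.
  rewrite e in tf *; rewrite -(top_coef tf) (top_coef tq) subrr; exact: span0.
have lead_f := relations_top Sf tf c00; move: tf nq at_root.
case: lead_f => [u|u v] -> {f Sf tq} tf nq at_root.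
  rewrite -(top_coef tf) (top_coef (top_dp_defect A i u)) invr1 scale1r.
  case/letter_reduct: nq => [[_ [<-] ->]|[p up ->]].
    by rewrite subrr; apply: span0.
  exact: dp_composition.
case/normal_two: nq => [[k [s [Ss es]]]|[p np ep]|[p np ep]].
- exact: at_root es.
- rewrite ep -mulZr; case: i tf np {at_root ep} => [|i] tf np.
    rewrite (coef_rb_defect0 tf) invr1 scale1r.
    have [[i]|[p' vp' ->]] := letter_reduct np; first by rewrite tail_order0.
    rewrite tail_order0 -[mono (Single _)](dern_op_mono A 0 u).
    exact: rb_composition_r.
  rewrite -(subrKA (dpmul i u v)); apply: spanD (dern_rb_defect_lead tf c00) _.
  by apply: dp_mul_composition; apply: normal_reduct np.
- rewrite ep -mulZl; case: i tf np {at_root ep} => [|i] tf np.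
    rewrite (coef_rb_defect0 tf) invr1 scale1r.
    have [[i] //|[p' up' ->]] := letter_reduct np.
    rewrite tail_order0 -[mono (Single _)](dern_op_mono A 0 v).
    exact: rb_composition_l.
  rewrite -(subrKA (dpmul i u v)); apply: spanD (dern_rb_defect_lead tf c00) _.
  rewrite -mulBl.
  have mb := supp_mono (A := A) (Q := eq (opw (tail_order i.+1) v)) erefl.
  have [[_ [<-] ->]|[p' up' ->]] := letter_reduct np.
    by rewrite subrr mul0l; apply: span0.
  apply: (red_mulr (dp_composition i up') mb) => u' _ u'u <-.
  by rewrite ltw_cat2r.
Qed.

(** Intersection compositions: a proper overlap requires two letters on both sides,
    hence two Rota-Baxter relations sharing one letter.  If the first is derived,
    [dpmul] reduces the overlap to the product of a relation [D(P(u)) - u] with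
    the second relation. *)
Lemma red_intersection f g i j mi mj ci cj (a b : word X) :
  relations f -> relations g ->
  top (dern i f) mi ci -> ci != 0 -> top (dern j g) mj cj -> cj != 0 ->
  wcat mi a = wcat b mj -> (bre (wcat mi a) < bre mi + bre mj)%N ->
  redlt (wcat mi a)
    (ci^-1 *: (dern i f ** mono a) - cj^-1 *: (mono b ** dern j g)).
Proof.
move=> Sf Sg tf ci0 tg cj0 e_ab lt_bre.
have rg := normal_reduct (normal_base Sg tg cj0).
rewrite -mulZl -mulZr.
have lead_f := relations_top Sf tf ci0; have lead_g := relations_top Sg tg cj0.
move: rg tf tg e_ab lt_bre.
have bre_a := bre_gt0 a; have bre_b := bre_gt0 b.
case: lead_f => [u|u v] ef rg tf tg e_ab.
  by rewrite e_ab !bre_cat /=; lia.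
case: lead_g rg tg e_ab => [u'|u' v'] eg rg tg e_ab.
  by rewrite !bre_cat /=; lia.
have eq_bre := congr1 (@bre X) e_ab; rewrite !bre_cat /= in eq_bre *.
move=> lt_bre.
have [la ea] : exists l, a = Single l by apply: bre1; lia.
have [lb eb] : exists l, b = Single l by apply: bre1; lia.
rewrite {}ea {}eb {a b bre_a bre_b eq_bre lt_bre} in e_ab *.
(* the shared letter identifies [u'] with [v] and [j] with [tail_order i] *)
case: e_ab eg rg tg => <- ej <- -> {lb} eg rg tg.
rewrite ef eg -ej {f g j ef eg ej Sf Sg} in tf tg rg *.
case: i tf tg rg => [|i] tf tg rg.
  rewrite tail_order0 in tg *.
  rewrite (coef_rb_defect0 tf) (coef_rb_defect0 tg) tail_order0 invr1 !scale1r.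
  by have := rb_intersection u v v'; rewrite !op_mono.
set a := mono (Single (Der _ (Op v'))).
pose l := opw (tail_order (tail_order i.+1)) v'.
have lead_f := dern_rb_defect_lead tf ci0.
rewrite -(subrKA (dpmul i u v ** a)) -mulBl; apply: spanD.
  apply: (red_mulr lead_f (supp_mono (Q := eq l) erefl)) => w _ w_lt <-.
  by rewrite -(ltw_cat2r l) in w_lt.
rewrite /dpmul -mulA mul_mono.
exact: dp_mul_composition.
Qed.

End Compositions.

(** * Star words *)

Section StarWords.
Variables (K : fieldType) (d : Order.disp_t) (X : orderType d) (lambda : K).
Variable A : free_algebra X lambda.
Variable S : A -> Prop.
Implicit Types (p q r s : A) (v w m z : word X) (c : K).
Implicit Types (u : word (option X)).

Local Notation dern i p := (iter i der p).
Local Notation normal := (normal S).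

(** Substitution for the star, with the operations of an abstract algebra; [substE]
    identifies it with [subst]. *)
Fixpoint star_subst_gen s (g : gen (option X)) : A :=
  match g with
  | Var (Some x) => mono (Single (Der 0 (Var x)))
  | Var None => s
  | Op w => op (star_subst s w)
  end
with star_subst_letter s (l : letter (option X)) : A :=
  let: Der i g := l in dern i (star_subst_gen s g)
with star_subst s (u : word (option X)) : A :=
  match u with
  | Single l => star_subst_letter s l
  | Cons l u' => star_subst_letter s l ** star_subst s u'
  end.

(** A linear map that is injective on words also reflects words: coefficients can be
    read off after applying it. *)
Lemma reflect_mono (f : A -> A) (phi : word X -> word X) p w : linear f ->
  (forall x y : word X, (x < y)%O -> (phi x < phi y)%O) ->
  (forall w, f (mono w) = mono (phi w)) -> f p = mono w ->
  exists2 z, p = mono z & w = phi z.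
Proof.
move=> lf phi_lt ef fp.
have phi_inj : injective phi.
  move=> x y exy; apply/eqP; case: ltgtP => // /phi_lt; by rewrite exy ltxx.
have coef_f v : coef (phi v) (f p) = coef v p.
  move: p {fp}; elim/mono_ind => [|c x p ih]; first by rewrite (lin_0 lf) !coef0.
  by rewrite lf ef !coefD !coefZ ih !coef_mono (inj_eq phi_inj).
have [z ez] : exists z, w = phi z.
  have im : supp (fun w => exists z, w = phi z) (f p).
    apply: (supp_linear lf (Q := fun=> True)) => // x _; rewrite ef.
    by apply: supp_mono; exists x.
  by apply: im; rewrite fp coef_mono eqxx oner_neq0.
exists z => //; apply: coef_ext => v.
by rewrite -coef_f fp ez !coef_mono (inj_eq phi_inj).
Qed.

Lemma star_free :
  (forall g, stars_gen g = 0%N ->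
     exists h, forall s, star_subst_gen s g = mono (Single (Der 0 h))) /\
  ((forall l, stars_letter l = 0%N ->
     exists l', forall s, star_subst_letter s l = mono (Single l')) /\
   (forall u, stars u = 0%N ->
     exists w, forall s, star_subst s u = mono w)).
Proof.
apply: words_ind => [[x|] //= _|w ih /= /ih [v ev]|i g ih /= /ih [h eh]
    |l ih /= /ih [l' el]|l ihl w ihw /= /eqP].
- by exists (Var x).
- by exists (Op v) => s; rewrite ev op_mono.
- by exists (Der i h) => s; rewrite eh dern_letter addn0.
- by exists (Single l').
rewrite addn_eq0 => /andP[/eqP /ihl [l' el] /eqP /ihw [v ev]].
by exists (Cons l' v) => s; rewrite el ev mul_mono.
Qed.

Section NormalStarWord.
Variables (s : A) (j : nat) (m : word X) (c : K).
Hypotheses (Ss : S s) (ts : top (dern j s) m c) (c0 : c != 0).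

Let star_normal_at (F : A -> A) :=
  forall w, F (mono m) = mono w -> normal (F (dern j s)) w c.

(** If putting the leading word in place of the star gives a single word, the result
    of the substitution is normal.  When the star carries a derivative, this
    forces the derived leading word to be a single word with coefficient [1], so
    that leading coefficients are preserved there too. *)
Lemma star_word_normal u :
  star_word u -> star_normal_at (fun p => star_subst p u).
Proof.
have sum_eq1 a b : (a + b = 1 -> a = 1 /\ b = 0 \/ a = 0 /\ b = 1)%N by lia.
suff [_ [_ ih]] :
    (forall g, stars_gen g = 1%N ->
      forall i, star_normal_at (fun p => dern i (star_subst_gen p g))) /\
    ((forall l, stars_letter l = 1%N ->
      star_normal_at (fun p => star_subst_letter p l)) /\
     (forall u, stars u = 1%N -> star_normal_at (fun p => star_subst p u))).
  by move=> /eqP; apply: ih.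
clear u.
apply: words_ind => [[x|] //= _ i w|w ih /= /ih nw i v|i g ih /= /ih nw w
    |l ih /= /ih //|l ihl u ihu /=].
- have [k k0 tk] := top_dern A i; have tm := tk _ _ _ (top_mono A m).
  rewrite mul1r in tm => ew; rewrite ew in tm.
  have [e_w e_k] := top_uniq tm (top_mono A w) (k0 m) (oner_neq0 _).
  have := tk _ _ _ ts; rewrite e_w e_k mulr1 -iterD.
  by move=> tis; apply: normal_base Ss tis c0.
- case/(@reflect_mono (fun p => dern i (op p)) (opw i)) => [|x y|x|z ez ->].
  + exact: dern_op_linear.
  + by rewrite ltw_opw.
  + by rewrite dern_op_mono.
  + by apply: normal_op; apply: nw.
- exact: nw.
- case/sum_eq1 => [[/ihl nl /(star_free.2.2) [v ev]]
    |[/(star_free.2.1) [l' el] /ihu nu]] w.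
  + rewrite !ev.
    case/(@reflect_mono (fun p => p ** mono v) (fun x => wcat x v)).
    * exact: mull_linear.
    * by move=> x y; rewrite ltw_cat2r.
    * by move=> x; rewrite mul_mono.
    * by move=> z ez ->; apply: normal_mulr; apply: nl.
  + rewrite !el; case/(@reflect_mono (mul (mono (Single l'))) (wcat (Single l'))).
    * exact: mulr_linear.
    * by move=> x y; rewrite ltw_cat2l.
    * by move=> x; rewrite mul_mono.
    * by move=> z ez ->; apply: normal_mull; apply: nu.
Qed.

End NormalStarWord.

Fixpoint some_gen (g : gen X) : gen (option X) :=
  match g with
  | Var x => Var (Some x)
  | Op w => Op (some_word w)
  end
with some_letter (l : letter X) : letter (option X) :=
  let: Der i g := l in Der i (some_gen g)
with some_word w : word (option X) :=
  match w with
  | Single l => Single (some_letter l)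
  | Cons l w' => Cons (some_letter l) (some_word w')
  end.

Lemma some_word_star w :
  stars (some_word w) = 0%N /\ forall s, star_subst s (some_word w) = mono w.
Proof.
suff [_ [_]] :
  (forall g, stars_gen (some_gen g) = 0%N /\
     forall s, star_subst_gen s (some_gen g) = mono (Single (Der 0 g))) /\
  ((forall l, stars_letter (some_letter l) = 0%N /\
     forall s, star_subst_letter s (some_letter l) = mono (Single l)) /\
   (forall w, stars (some_word w) = 0%N /\
     forall s, star_subst s (some_word w) = mono w)) by apply.
apply: words_ind => [x|{}w [e ew]|i g [e eg]|l [e el]|l [e el] {}w [e' ew]] //=.
- by split=> // s; rewrite ew op_mono.
- by split=> // s; rewrite eg dern_letter addn0.
- by rewrite e e'; split=> // s; rewrite el ew mul_mono.
Qed.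

Lemma stars_cat u u' : stars (wcat u u') = (stars u + stars u')%N.
Proof. by elim: u => //= l u ->; rewrite addnA. Qed.

Lemma star_subst_cat s u u' :
  star_subst s (wcat u u') = star_subst s u ** star_subst s u'.
Proof. by elim: u => //= l u ->; rewrite mulA. Qed.

(** Normal words are realized by star words whose star carries no derivative. *)
Lemma normal_star p w c : normal p w c -> exists u s j m,
  [/\ star_word u, S s, p = star_subst (dern j s) u,
      exists2 b, top (dern j s) m b & b != 0
    & star_subst (mono m) u = mono w].
Proof.
elim=> {p w c} [i s m c Ss ts c0|i p w c _|v p w c _|v p w c _].
- by exists (Single (Der 0 (Var None))), s, i, m; split=> //; exists c.
- move=> [u [s [j [m [su Ss -> tm eu]]]]].
  exists (Single (Der i (Op u))), s, j, m; split=> //=.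
  by rewrite eu dern_op_mono.
- move=> [u [s [j [m [/eqP su Ss -> tm eu]]]]]; have [sv ev] := some_word_star v.
  exists (wcat (some_word v) u), s, j, m.
  by rewrite /star_word stars_cat sv su !star_subst_cat !ev eu mul_mono.
- move=> [u [s [j [m [/eqP su Ss -> tm eu]]]]]; have [sv ev] := some_word_star v.
  exists (wcat u (some_word v)), s, j, m.
  by rewrite /star_word stars_cat sv su !star_subst_cat !ev eu mul_mono.
Qed.

End StarWords.

(** * The algebra of finitely supported functions on words *)

Section Malg.
Variables (K : fieldType) (X : choiceType) (lambda : K).
Notation A := {malg K[word X]}.
Implicit Types (p q : A) (w : word X) (F : word X -> A).

Lemma malg_sum p : p = \sum_(w <- msupp p) p@_w *: << w >>.
Proof.
rewrite {1}(monalgE p); apply: eq_bigr => w _.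
by apply/malgP => k; rewrite mcoeffZ !mcoeffU mulr_natr.
Qed.

Lemma linextEw (E : {fset word X}) F p : (msupp p `<=` E)%fset ->
  linext F p = \sum_(w <- E) p@_w *: F w.
Proof.
move=> sub; rewrite /linext (big_fset_incl _ sub) // => w _.
by move/mcoeff_outdom->; rewrite scale0r.
Qed.

Lemma linext_linear F : linear (linext F).
Proof.
move=> c p q; pose E := (msupp p `|` msupp q)%fset.
rewrite !(@linextEw E) ?fsubsetUl ?fsubsetUr //; last first.
  apply: fsubset_trans (msuppD_le _ _) _.
  by rewrite fsetSU // msuppZ_le.
rewrite scaler_sumr -big_split /=; apply: eq_bigr => w _.
by rewrite mcoeffD mcoeffZ scalerDl scalerA.
Qed.

Lemma linextU F w : linext F << w >> = F w.
Proof. by rewrite /linext msuppU oner_eq0 big_seq_fset1 mcoeffUU scale1r. Qed.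

Lemma amulr_linear p : linear (amul p).
Proof.
have E q : amul p q =
    \sum_(u <- msupp p) p@_u *: linext (fun v => << wcat u v >>) q by [].
move=> c q r; rewrite !E scaler_sumr -big_split /=.
apply: eq_bigr => w _.
by rewrite linext_linear scalerDr !scalerA mulrC.
Qed.

Definition malg_free_algebra : free_algebra X lambda.
Proof.
apply: (@FreeAlgebra K X lambda A (fun w p => p@_w) (fun w => << w >>)
  (@amul K X) (Dop lambda) (@Pop K X)).
- by move=> w c p q; rewrite mcoeffD mcoeffZ.
- by move=> v w; rewrite mcoeffU; case: eqP.
- move=> p; exists (msupp p : seq _); last exact: malg_sum.
  by move=> w; rewrite mcoeff_neq0.
- by move=> q; apply: linext_linear.
- exact: amulr_linear.
- by move=> u v; rewrite /amul !linextU.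
- exact: linext_linear.
- by move=> i g; rewrite /Dop linextU.
- by move=> l w; rewrite /Dop !linextU.
- exact: linext_linear.
- by move=> w; rewrite /Pop linextU.
Defined.

End Malg.

Section Bridge.
Variables (K : fieldType) (d : Order.disp_t) (X : orderType d) (lambda : K).
Notation A := {malg K[word X]}.
Local Notation F := (malg_free_algebra X lambda).
Implicit Types (p q s : A) (m w : word X) (c : K).

Lemma top_lead p m c : top (p : F) m c -> c != 0 -> lead p m.
Proof.
move=> tp c0; split; first by rewrite -mcoeff_neq0 [_@__](top_coef tp).
by move=> v; rewrite -mcoeff_neq0; apply: (top_supp tp).
Qed.

Lemma lead_top p m : lead p m -> top (p : F) m p@_m /\ p@_m != 0.
Proof.
case=> mp le_m; split; last by rewrite mcoeff_neq0.
move=> v; rewrite coefB coefZ coef_mono -[coef v _]/(p@_v).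
case: (eqVneq m v) => [->|neq]; first by rewrite mulr1 subrr eqxx.
rewrite mulr0 subr0 mcoeff_neq0 => /le_m; rewrite le_eqVlt => /predU1P[e|//].
by rewrite e eqxx in neq.
Qed.

Lemma substE s (u : word (option X)) :
  subst lambda s u = star_subst (s : F) u.
Proof.
suff [_ [_]] :
  (forall g, subst_gen lambda s g = star_subst_gen (s : F) g) /\
  ((forall l, subst_letter lambda s l = star_subst_letter (s : F) l) /\
   (forall u, subst lambda s u = star_subst (s : F) u)) by apply.
by apply: words_ind => [[x|]|w /= ->|i g /= ->|l /= ->|l /= -> {}u ->].
Qed.

Lemma relationsE s : diff_rota_baxter lambda s <-> relations (s : F).
Proof.
split; case=> *; first exact: rb_relation.
- exact: dp_relation.
- exact: RBrel.
- exact: DPrel.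
Qed.

Lemma congr_mod0 (S : A -> Prop) w : congr_mod lambda S w 0 0.
Proof.
exists 0%N, (fun=> 0), (fun=> Single (Der 0 (Var None))), (fun=> 0), (fun=> 0%N).
by split; [case|rewrite big_ord0 subrr].
Qed.

Lemma congr_mod_cons (S : A -> Prop) w a u s j v p :
  star_word u -> S s -> normal_lead lambda u (Diter lambda j s) v -> (v < w)%O ->
  congr_mod lambda S w p 0 ->
  congr_mod lambda S w (a *: subst lambda (Diter lambda j s) u + p) 0.
Proof.
move=> su Ss nv vw [n [al [us [ss [js [Hn ep]]]]]].
exists n.+1, (fun i => if unlift ord0 i is Some k then al k else a),
  (fun i => if unlift ord0 i is Some k then us k else u),
  (fun i => if unlift ord0 i is Some k then ss k else s),
  (fun i => if unlift ord0 i is Some k then js k else j); split.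
  by move=> i; case: (unlift ord0 i) => [k|]; [exact: Hn | split=> //; exists v].
rewrite subr0 in ep; rewrite subr0 big_ord_recl unlift_none ep; congr (_ + _).
by apply: eq_bigr => i _; rewrite liftK.
Qed.

Lemma redlt_congr_mod w p : redlt (@relations K d X lambda F) w p ->
  congr_mod lambda (@diff_rota_baxter K d X lambda) w p 0.
Proof.
elim=> [|a q r [v [c [nq vw]]] _ ih]; first exact: congr_mod0.
have [tq c0] := normal_top nq.
have [u [s [j [m [su /relationsE Ss eq [b tm b0] eu]]]]] := normal_star nq.
rewrite {1}eq -substE; apply: congr_mod_cons su Ss _ vw ih; split.
  by rewrite substE -[Diter _ _ _]/(iter j der (s : F)) -eq; apply: top_lead tq c0.
by exists m; [apply: top_lead tm b0|rewrite substE].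
Qed.

End Bridge.

Theorem theorem4p2 (K : fieldType) (lambda : K) (d : Order.disp_t)
    (X : orderType d) (wfX : well_founded (fun x y : X => (x < y)%O)) :
  groebner_shirshov lambda (@diff_rota_baxter K d X lambda).
Proof.
pose F := malg_free_algebra X lambda.
split=> [f /relationsE Sf|f g w h /relationsE Sf /relationsE Sg].
  have [w tf] : exists w, top (f : F) w 1.
    case: Sf => [u v|u].
      by exists (wcat (opw 0 u) (opw 0 v)); apply: top_rb_defect.
    by exists (opw 1 u); apply: (top_dp_defect F 0).
  by exists w; [exact: (top_lead tf (oner_neq0 _)) | exact: (top_coef tf)].
case=> [i j a b mf mg mi mj|i j u mj].
  move=> /(lead_top lambda)[tf f0] /(lead_top lambda)[tg g0].
  move=> /(lead_top lambda)[ti i0] /(lead_top lambda)[tj j0] -> e_ab lt_bre.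
  have [kf kf0 tkf] := top_dern F i; have [kg kg0 tkg] := top_dern F j.
  have [emi _] := top_uniq ti (tkf _ _ _ tf) i0 (mulf_neq0 f0 (kf0 _)).
  have [emj _] := top_uniq tj (tkg _ _ _ tg) j0 (mulf_neq0 g0 (kg0 _)).
  apply: redlt_congr_mod; apply: (red_intersection Sf Sg ti i0 tj j0 e_ab).
  (* deriving a polynomial does not change the breadth of its leading word *)
  by rewrite {2}emi emj !bre_dwordn.
move=> su /(lead_top lambda)[ti i0] /(lead_top lambda)[tj j0] eu.
apply: redlt_congr_mod; apply: (red_including Sf ti i0).
rewrite substE; apply: (star_word_normal Sg tj j0 su); rewrite -substE.
exact: eu.
Qed.
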